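(* Let $H=\{H_\alpha\}_{\alpha\in G}$ be a Hopf $G$-coalgebra with bijective antipode and let $A=\{A_\alpha\}_{\alpha\in G}$ be a right $H$-comodule Poisson algebra. Suppose that there is a right $H$-colinear map $\phi=\{\phi_\alpha\}_{\alpha\in G}:H\rightarrow A^A$ such that $\phi_\alpha(1_{H_\alpha})=1_{A_\alpha}$ for all $\alpha\in G$. (1) If $H$ is commutative or $\phi$ is an algebra map, then every Poisson $(A,H)$-Hopf module which is injective as a Lie $A$-module is an injective $(\underline{A},H)$-comodule. (2) If $H$ is commutative and $\phi$ is an algebra map, then every Poisson $(A,H)$-Hopf module which is injective as a Poisson $A$-module is an injective Poisson $(A,H)$-Hopf module.
   Context: $k$ is a field; all vector spaces, tensor products and maps are over $k$. $G$ is an abelian group with unit $e$. Hopf $G$-coalgebra: a family $H=\{H_\alpha\}_{\alpha\in G}$ of algebras with algebra maps $\Delta_{\alpha,\beta}:H_{\alpha\beta}\to H_\alpha\otimes H_\beta$ and $\varepsilon:H_e\to k$ such that $(\Delta_{\alpha,\beta}\otimes id)\Delta_{\alpha\beta,\gamma}=(id\otimes\Delta_{\beta,\gamma})\Delta_{\alpha,\beta\gamma}$ and $(id\otimes\varepsilon)\Delta_{\alpha,e}=id=(\varepsilon\otimes id)\Delta_{e,\alpha}$, together with linear maps (the antipode) $S_\alpha:H_\alpha\to H_{\alpha^{-1}}$ with $m_\alpha(S_{\alpha^{-1}}\otimes id)\Delta_{\alpha^{-1},\alpha}=\varepsilon 1_\alpha=m_\alpha(id\otimes S_{\alpha^{-1}})\Delta_{\alpha,\alpha^{-1}}$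 on $H_e$. The antipode is bijective if every $S_\alpha$ is bijective. $H$ is commutative if every $H_\alpha$ is. Right $H$-comodule: a family $M=\{M_\alpha\}_{\alpha\in G}$ of vector spaces with linear maps $\rho_{\alpha,\beta}:M_{\alpha\beta}\to M_\alpha\otimes H_\beta$, written $\rho_{\alpha,\beta}(m)=m_{(0,\alpha)}\otimes m_{(1,\beta)}$, such that $(id\otimes\Delta_{\beta,\gamma})\rho_{\alpha,\beta\gamma}=(\rho_{\alpha,\beta}\otimes id)\rho_{\alpha\beta,\gamma}$ and $(id\otimes\varepsilon)\rho_{\alpha,e}=id$. A morphism of families is a family of linear maps $f_\alpha:M_\alpha\to N_\alpha$; it is $H$-colinear if $\rho_{\alpha,\beta}f_{\alpha\beta}=(f_\alpha\otimes id)\rho_{\alpha,\beta}$. $H$ is a right $H$-comodule via $\Delta$. Right $H$-comodule Poisson algebra: a family $A=\{A_\alpha\}$ of (commutative) Poisson algebras which is a right $H$-comodule such that each $\rho_{\alpha,\beta}:A_{\alpha\beta}\to A_\alpha\otimes H_\beta$ is an algebra map and $\rho_{\alpha,\beta}(\{a,b\})=\{a_{(0,\alpha)},b_{(0,\alpha)}\}\otimes a_{(1,\beta)}b_{(1,\beta)}$ for all $a,b\in A_{\alpha\beta}$. Lie $A$-module: a family $M=\{M_\alpha\}$ with each $M_\alpha$ a Lie module over the Lie algebra $(A_\alpha,\{\,,\})$, action written $a\diamond m$. Poisson $A$-module: a family $M$ with each $M_\alpha$ an $A_\alpha$-module (action $a\cdot m$) and a Lie $A_\alpha$-module, with $a\diamond(b\cdot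 m)=\{a,b\}\cdot m+b\cdot(a\diamond m)$ and $(ab)\diamond m=a\cdot(b\diamond m)+b\cdot(a\diamond m)$ for $a,b\in A_\alpha,m\in M_\alpha$. $(\underline{A},H)$-comodule: a Lie $A$-module $M$ that is a right $H$-comodule with $\rho_{\alpha,\beta}(a\diamond m)=a_{(0,\alpha)}\diamond m_{(0,\alpha)}\otimes a_{(1,\beta)}m_{(1,\beta)}$ for $a\in A_{\alpha\beta},m\in M_{\alpha\beta}$. Poisson $(A,H)$-Hopf module: a Poisson $A$-module $M$ that is a right $H$-comodule satisfying the previous identity and $\rho_{\alpha,\beta}(a\cdot m)=a_{(0,\alpha)}\cdot m_{(0,\alpha)}\otimes a_{(1,\beta)}m_{(1,\beta)}$. Morphisms are families of linear maps preserving all the structures: Lie $A$-linear maps for Lie $A$-modules; $A$-linear and Lie $A$-linear maps for Poisson $A$-modules; Lie $A$-linear and $H$-colinear maps for $(\underline{A},H)$-comodules; $A$-linear, Lie $A$-linear and $H$-colinear maps for Poisson $(A,H)$-Hopf modules. ''Injective'' (as a Lie $A$-module, $(\underline{A},H)$-comodule, etc.) means injective object of the corresponding category. $A^A=\{A_\alpha^{A_\alpha}\}_{\alpha\in G}$ is the family of Poisson centers $A_\alpha^{A_\alpha}=\{c\in A_\alpha:\{a,c\}=0\ \forall a\in A_\alpha\}$; it is an $H$-subcomodule and family of subalgebras of $A$. $\phi$ is an algebra map if every $\phi_\alpha$ is an algebra map. *)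

(* Defs.v *)
From HB Require Import structures.
From mathcomp Require Import all_boot all_order all_algebra.
From mathcomp Require Import boolp.

Set Implicit Arguments.
Unset Strict Implicit.
Unset Printing Implicit Defensive.

Import GRing.Theory.
Local Open Scope ring_scope.
Local Open Scope quotient_scope.

(* Associative unital algebras, possibly zero: MathComp's algType requires    *)
(* 1 != 0, but the components of a Hopf G-coalgebra may vanish.               *)
Record pzAlgType (k : fieldType) := PzAlg {
  alg_ring : pzRingType;
  alg_scale : k -> alg_ring -> alg_ring;
  alg_scaleA : forall a b u, alg_scale a (alg_scale b u) = alg_scale (a * b) u;
  alg_scale1 : left_id 1 alg_scale;
  alg_scaleDr : right_distributive alg_scale +%R;
  alg_scaleDl : forall u, {morph alg_scale^~ u : a b / a + b};
  alg_scaleAl : forall a u v, alg_scale a (u * v) = alg_scale a u * v;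
  alg_scaleAr : forall a u v, alg_scale a (u * v) = u * alg_scale a v
}.

Definition alg_sort (k : fieldType) (A : pzAlgType k) : Type := alg_ring A.
Coercion alg_sort : pzAlgType >-> Sortclass.

HB.instance Definition _ (k : fieldType) (A : pzAlgType k) :=
  GRing.PzRing.copy (alg_sort A) (alg_ring A).
HB.instance Definition _ (k : fieldType) (A : pzAlgType k) :=
  GRing.Zmodule_isLmodule.Build k (alg_sort A)
    (@alg_scaleA k A) (@alg_scale1 k A) (@alg_scaleDr k A) (@alg_scaleDl k A).

Coercion alg_lmod (k : fieldType) (A : pzAlgType k) : lmodType k := alg_sort A.

Lemma pzscalerAl (k : fieldType) (A : pzAlgType k) (a : k) (u v : A) :
  a *: (u * v) = (a *: u) * v.
Proof. exact: alg_scaleAl. Qed.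

Lemma pzscalerAr (k : fieldType) (A : pzAlgType k) (a : k) (u v : A) :
  a *: (u * v) = u * (a *: v).
Proof. exact: alg_scaleAr. Qed.

Record poissonAlgType (k : fieldType) := PoissonAlg {
  poisson_alg :> pzAlgType k;
  lie : {bilinear poisson_alg -> poisson_alg -> poisson_alg};
  poisson_mulC : commutative ( *%R : poisson_alg -> poisson_alg -> poisson_alg);
  liexx : forall a, lie a a = 0;
  lie_jacobi : forall a b c,
    lie a (lie b c) + lie b (lie c a) + lie c (lie a b) = 0;
  lie_leibniz : forall a b c, lie a (b * c) = lie a b * c + b * lie a c
}.

(* A colinear map into the subcomodule of Poisson centers is given as a       *)
(* colinear map into A with central values: over a field A^A (x) H embeds in  *)
(* A (x) H, and the coaction of A^A is the restriction of that of A.          *)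
Definition poisson_center (k : fieldType) (A : poissonAlgType k) (c : A) :=
  forall a : A, lie A a c = 0.

(* V (x) W is the set of formal sums of pairs (v, w) modulo the congruence    *)
(* generated by bilinearity.                                                  *)
Inductive tens_rel (k : fieldType) (V W : lmodType k) :
    seq (V * W) -> seq (V * W) -> Prop :=
| tens_refl s : tens_rel s s
| tens_sym s t : tens_rel s t -> tens_rel t s
| tens_trans s t u : tens_rel s t -> tens_rel t u -> tens_rel s u
| tens_cat s s' t t' :
    tens_rel s s' -> tens_rel t t' -> tens_rel (s ++ t) (s' ++ t')
| tens_catC s t : tens_rel (s ++ t) (t ++ s)
| tens_0l w : tens_rel [:: (0, w)] [::]
| tens_Dl v v' w : tens_rel [:: (v + v', w)] [:: (v, w); (v', w)]
| tens_Dr v w w' : tens_rel [:: (v, w + w')] [:: (v, w); (v, w')]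
| tens_Z a v w : tens_rel [:: (a *: v, w)] [:: (v, a *: w)].

Section Tensor.
Variables (k : fieldType) (V W : lmodType k).
Implicit Types (s t : seq (V * W)).

Definition tens_relb s t : bool := `[< tens_rel s t >].

Lemma tens_relb_equiv : equiv_class_of tens_relb.
Proof.
split=> [s|s t|t s u].
- exact/asboolP/tens_refl.
- by apply/asboolP/asboolP; apply: tens_sym.
- by move=> /asboolP st /asboolP tu; apply/asboolP; apply: tens_trans st tu.
Qed.

Canonical tens_relb_equivRel := EquivRelPack tens_relb_equiv.

Definition tensor := {eq_quot tens_relb}.
HB.instance Definition _ := Choice.on tensor.
HB.instance Definition _ := EqQuotient.on tensor.

Definition tpi s : tensor := \pi_tensor s.

Lemma tpiP s t : tpi s = tpi t <-> tens_rel s t.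
Proof.
by split=> [/eqmodP/asboolP //|st]; apply/eqmodP/asboolP.
Qed.

Lemma tpiK (x : tensor) : tpi (repr x) = x.
Proof. exact: reprK. Qed.

Lemma tens_repr s : tens_rel (repr (tpi s)) s.
Proof. by apply/tpiP; rewrite tpiK. Qed.

Definition tscale_seq (a : k) s := [seq (a *: p.1, p.2) | p <- s].

Lemma tens_rel_scale a s t :
  tens_rel s t -> tens_rel (tscale_seq a s) (tscale_seq a t).
Proof.
elim=> {s t} /=.
- by move=> s; apply: tens_refl.
- by move=> s t _; apply: tens_sym.
- by move=> s t u _ st _; apply: tens_trans.
- by move=> s s' t t' _ ss' _ tt'; rewrite /tscale_seq !map_cat; apply: tens_cat.
- by move=> s t; rewrite /tscale_seq !map_cat; apply: tens_catC.
- by move=> w; rewrite scaler0; apply: tens_0l.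
- by move=> v v' w; rewrite scalerDr; apply: tens_Dl.
- by move=> v w w'; apply: tens_Dr.
- by move=> b v w; rewrite scalerA mulrC -scalerA; apply: tens_Z.
Qed.

Definition tzero : tensor := tpi [::].
Definition tadd (x y : tensor) : tensor := tpi (repr x ++ repr y).
Definition tscale (a : k) (x : tensor) : tensor := tpi (tscale_seq a (repr x)).
Definition topp (x : tensor) : tensor := tscale (-1) x.

Lemma tadd_pi s t : tadd (tpi s) (tpi t) = tpi (s ++ t).
Proof. by apply/tpiP; apply: tens_cat; apply: tens_repr. Qed.

Lemma tscale_pi a s : tscale a (tpi s) = tpi (tscale_seq a s).
Proof. by apply/tpiP; apply/tens_rel_scale/tens_repr. Qed.

Lemma taddA : associative tadd.
Proof.
by move=> x y z; rewrite -(tpiK x) -(tpiK y) -(tpiK z) !tadd_pi catA.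
Qed.

Lemma taddC : commutative tadd.
Proof.
move=> x y; rewrite -(tpiK x) -(tpiK y) !tadd_pi; apply/tpiP; exact: tens_catC.
Qed.

Lemma tadd0 : left_id tzero tadd.
Proof. by move=> x; rewrite -(tpiK x) tadd_pi. Qed.

Lemma tscaleDl (x : tensor) a b :
  tscale (a + b) x = tadd (tscale a x) (tscale b x).
Proof.
rewrite -(tpiK x) !tscale_pi tadd_pi; apply/tpiP.
elim: (repr x) => [|[v w] s ihs]; first exact: tens_refl.
have S c : tscale_seq c ((v, w) :: s) = [:: (c *: v, w)] ++ tscale_seq c s by [].
rewrite !S; apply: tens_trans (tens_cat (tens_refl _) ihs) _.
rewrite scalerDl.
apply: tens_trans (tens_cat (tens_Dl _ _ _) (tens_refl _)) _.
rewrite -[[:: _; _]]/([:: _] ++ [:: _]) -!catA.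
apply: tens_cat (tens_refl _) _; rewrite !catA.
apply: tens_cat (tens_refl _); exact: tens_catC.
Qed.

Lemma tscale0 (x : tensor) : tscale 0 x = tzero.
Proof.
rewrite -(tpiK x) tscale_pi; apply/tpiP.
elim: (repr x) => [|[v w] s ihs]; first exact: tens_refl.
rewrite /tscale_seq /= scale0r.
exact: (tens_cat (tens_0l _ w) ihs).
Qed.

Lemma tscale1 (x : tensor) : tscale 1 x = x.
Proof.
rewrite -(tpiK x) tscale_pi; congr tpi.
by rewrite -[RHS]map_id; apply: eq_map => -[v w]; rewrite scale1r.
Qed.

Lemma taddN : left_inverse tzero topp tadd.
Proof.
by move=> x; rewrite -{2}(tscale1 x) -tscaleDl addNr tscale0.
Qed.

HB.instance Definition _ :=
  GRing.isZmodule.Build tensor taddA taddC tadd0 taddN.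

Lemma tscaleA a b (x : tensor) : tscale a (tscale b x) = tscale (a * b) x.
Proof.
rewrite -(tpiK x) !tscale_pi /tscale_seq -map_comp; congr tpi.
by apply: eq_map => -[v w] /=; rewrite scalerA.
Qed.

Lemma tscaleDr : right_distributive tscale +%R.
Proof.
move=> a x y; rewrite -(tpiK x) -(tpiK y).
have E s t : tpi s + tpi t = tpi (s ++ t) by exact: tadd_pi.
by rewrite E !tscale_pi E /tscale_seq map_cat.
Qed.

HB.instance Definition _ := GRing.Zmodule_isLmodule.Build k tensor
  tscaleA tscale1 tscaleDr tscaleDl.

Definition tens (v : V) (w : W) : tensor := tpi [:: (v, w)].

Lemma tens_bilinear : bilinear_for *:%R *:%R tens.
Proof.
have D s t : tpi s + tpi t = tpi (s ++ t) by exact: tadd_pi.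
have Z a s : a *: tpi s = tpi (tscale_seq a s) by exact: tscale_pi.
split=> [w|v] a x y; rewrite /= /tens Z D; apply/tpiP => /=.
- exact: tens_Dl.
- apply: tens_trans (tens_Dr _ _ _) _.
  exact: (tens_cat (tens_sym (tens_Z a v x)) (tens_refl [:: (v, y)])).
Qed.

Lemma tens_sum (x : tensor) : x = \sum_(p <- repr x) tens p.1 p.2.
Proof.
rewrite -{1}(tpiK x); elim: (repr x) => [|[v w] s ihs].
  by rewrite big_nil.
by rewrite big_cons -ihs; symmetry; apply: tadd_pi.
Qed.

(* The map out of V (x) W induced by b; meaningful for bilinear b (tliftE).   *)
Definition tlift (U : lmodType k) (b : V -> W -> U) (x : tensor) : U :=
  \sum_(p <- repr x) b p.1 p.2.

Section Lift.
Variables (U : lmodType k) (b : V -> W -> U).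
Hypothesis bP : bilinear_for *:%R *:%R b.

Let bl w : linear (b^~ w). Proof. by move=> a x y; apply: bP.1. Qed.
Let br v : linear (b v). Proof. by move=> a x y; apply: bP.2. Qed.

Let bD v v' w : b (v + v') w = b v w + b v' w.
Proof. by rewrite -[v]scale1r bl !scale1r. Qed.
Let bDr v w w' : b v (w + w') = b v w + b v w'.
Proof. by rewrite -[w]scale1r br !scale1r. Qed.
Let b0 w : b 0 w = 0.
Proof. by apply: (addrI (b 0 w)); rewrite -bD !addr0. Qed.
Let b0r v : b v 0 = 0.
Proof. by apply: (addrI (b v 0)); rewrite -bDr !addr0. Qed.
Let bZ a v w : b (a *: v) w = a *: b v w.
Proof. by rewrite -[a *: v]addr0 bl b0 addr0. Qed.
Let bZr a v w : b v (a *: w) = a *: b v w.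
Proof. by rewrite -[a *: w]addr0 br b0r addr0. Qed.

Lemma tlift_rel s t : tens_rel s t ->
  \sum_(p <- s) b p.1 p.2 = \sum_(p <- t) b p.1 p.2.
Proof.
elim=> {s t} //=.
- by move=> s t u _ -> _ ->.
- by move=> s s' t t' _ ss _ tt; rewrite !big_cat /= ss tt.
- by move=> s t; rewrite !big_cat /= addrC.
- by move=> w; rewrite big_cons !big_nil addr0.
- by move=> v v' w; rewrite !big_cons !big_nil !addr0 bD.
- by move=> v w w'; rewrite !big_cons !big_nil !addr0 bDr.
- by move=> a v w; rewrite !big_cons !big_nil !addr0 /= bZ bZr.
Qed.

Lemma tlift_pi s : tlift b (tpi s) = \sum_(p <- s) b p.1 p.2.
Proof. exact/tlift_rel/tens_repr. Qed.

Lemma tliftE v w : tlift b (tens v w) = b v w.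
Proof. by rewrite tlift_pi big_cons big_nil addr0. Qed.

Lemma tlift_linear : linear (tlift b).
Proof.
move=> a x y; rewrite -(tpiK x) -(tpiK y).
have -> : a *: tpi (repr x) = tpi (tscale_seq a (repr x)) by exact: tscale_pi.
have -> : forall s t, tpi s + tpi t = tpi (s ++ t) by exact: tadd_pi.
rewrite !tlift_pi big_cat big_map scaler_sumr /=; congr (_ + _).
by apply: eq_bigr => p _; rewrite bZ.
Qed.

End Lift.

Lemma tens_ext (U : lmodType k) (f g : tensor -> U) :
  linear f -> linear g -> (forall v w, f (tens v w) = g (tens v w)) -> f =1 g.
Proof.
move=> lf lg fg x.
pose F := GRing.isLinear.Build k tensor U *:%R f lf.
pose G := GRing.isLinear.Build k tensor U *:%R g lg.
pose f' : {linear tensor -> U} := HB.pack f F.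
pose g' : {linear tensor -> U} := HB.pack g G.
rewrite (tens_sum x) -[f]/(f' : _ -> _) -[g]/(g' : _ -> _) !raddf_sum.
by apply: eq_bigr => p _; apply: fg.
Qed.

End Tensor.

Notation "V ⊗ W" := (tensor V W) (at level 40, left associativity) : type_scope.

Section TensorMaps.
Variable k : fieldType.
Implicit Types U V W : lmodType k.

Definition tmap V V' W W' (f : V -> V') (g : W -> W') : V ⊗ W -> V' ⊗ W' :=
  tlift (fun v w => tens (f v) (g w)).

(* (u (x) u', v (x) v') |-> f u v (x) g u' v'                                 *)
Definition tmap2 U U' V V' W W' (f : U -> V -> W) (g : U' -> V' -> W') :
    U ⊗ U' -> V ⊗ V' -> W ⊗ W' :=
  fun x y => tlift (fun u u' => tlift (fun v v' => tens (f u v) (g u' v')) y) x.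

Definition tassoc U V W : (U ⊗ V) ⊗ W -> U ⊗ (V ⊗ W) :=
  fun x => tlift (fun y w => tlift (fun u v => tens u (tens v w)) y) x.

Definition trunit V : V ⊗ k^o -> V := tlift (fun v (c : k^o) => (c : k) *: v).

Definition tlunit V : k^o ⊗ V -> V := tlift (fun (c : k^o) v => (c : k) *: v).

Lemma tensl V W (w : W) : linear (fun v : V => tens v w).
Proof. by move=> a x y; apply: (tens_bilinear V W).1. Qed.

Lemma tensr V W (v : V) : linear (fun w : W => tens v w).
Proof. by move=> a x y; apply: (tens_bilinear V W).2. Qed.

Lemma tmap_subproof V V' W W' (f : V -> V') (g : W -> W') :
  linear f -> linear g -> bilinear_for *:%R *:%R (fun v w => tens (f v) (g w)).
Proof.
by move=> lf lg; split=> ? a x y; rewrite ?lf ?lg ?tensl ?tensr.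
Qed.

Lemma tmapE V V' W W' (f : V -> V') (g : W -> W') (v : V) (w : W) :
  linear f -> linear g -> tmap f g (tens v w) = tens (f v) (g w).
Proof. by move=> lf lg; apply/tliftE/tmap_subproof. Qed.

Lemma tmap_linear V V' W W' (f : V -> V') (g : W -> W') :
  linear f -> linear g -> linear (tmap f g).
Proof. by move=> lf lg; apply/tlift_linear/tmap_subproof. Qed.

Lemma tlift_comb V W U (b c : V -> W -> U) a (x : V ⊗ W) :
  tlift (fun v w => a *: b v w + c v w) x = a *: tlift b x + tlift c x.
Proof. by rewrite /tlift scaler_sumr -big_split. Qed.

Lemma eq_tlift V W U (b c : V -> W -> U) (x : V ⊗ W) :
  b =2 c -> tlift b x = tlift c x.
Proof. by move=> bc; apply: eq_bigr => p _; apply: bc. Qed.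

Section Tmap2.
Variables U U' V V' W W' : lmodType k.
Variables (f : U -> V -> W) (g : U' -> V' -> W').
Hypotheses (fP : bilinear_for *:%R *:%R f) (gP : bilinear_for *:%R *:%R g).

Let inner u u' : bilinear_for *:%R *:%R (fun v v' => tens (f u v) (g u' v')).
Proof.
by apply: tmap_subproof => a x y; rewrite ?(fP.2 u) ?(gP.2 u').
Qed.

Let outer y : bilinear_for *:%R *:%R
  (fun u u' => tlift (fun v v' => tens (f u v) (g u' v')) y).
Proof.
split=> [u'|u] a x z; rewrite -tlift_comb; apply: eq_tlift => v v'.
- by rewrite -tensl; congr tens; apply: fP.1.
- by rewrite -tensr; congr tens; apply: gP.1.
Qed.

Lemma tmap2E u u' v v' :
  tmap2 f g (tens u u') (tens v v') = tens (f u v) (g u' v').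
Proof. by rewrite /tmap2 (tliftE (outer _)) (tliftE (inner _ _)). Qed.

Lemma tmap2_bilinear : bilinear_for *:%R *:%R (tmap2 f g).
Proof.
split=> [y|x] a x1 x2; first exact: (tlift_linear (outer y)).
rewrite /tmap2 -tlift_comb; apply: eq_tlift => u u'.
exact: (tlift_linear (inner u u')).
Qed.

End Tmap2.

Let tassoc_inner U V W (w : W) :
  bilinear_for *:%R *:%R (fun (u : U) (v : V) => tens u (tens v w)).
Proof. by split=> ? a x y; rewrite ?tensl ?tensr. Qed.

Let tassoc_outer U V W : bilinear_for *:%R *:%R
  (fun (y : U ⊗ V) (w : W) => tlift (fun u v => tens u (tens v w)) y).
Proof.
split=> [w|y] a x z; first exact/tlift_linear/tassoc_inner.
by rewrite -tlift_comb; apply: eq_tlift => u v; rewrite !tensr.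
Qed.

Lemma tassocE U V W (u : U) (v : V) (w : W) :
  tassoc (tens (tens u v) w) = tens u (tens v w).
Proof. by rewrite /tassoc (tliftE (tassoc_outer _ _ _)) tliftE. Qed.

Lemma trunitE V (v : V) (c : k) : trunit (tens v (c : k^o)) = c *: v.
Proof.
rewrite /trunit tliftE //; split=> [d|w] a x y.
- by rewrite scalerDr scalerA (@mulrC k) -scalerA.
- by have E (b d e : k) : (b * d + e) *: w = b *: (d *: w) + e *: w;
    [rewrite scalerDl scalerA | apply: E].
Qed.

Lemma tlunitE V (v : V) (c : k) : tlunit (tens (c : k^o) v) = c *: v.
Proof.
rewrite /tlunit tliftE //; split=> [w|d] a x y.
- by have E (b d e : k) : (b * d + e) *: w = b *: (d *: w) + e *: w;
    [rewrite scalerDl scalerA | apply: E].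
- by rewrite scalerDr scalerA (@mulrC k) -scalerA.
Qed.

End TensorMaps.

Section TensorAlgebra.
Variables (k : fieldType) (A B : pzAlgType k).
Implicit Types x y z : A ⊗ B.

Lemma pzmul_bilinear (C : pzAlgType k) :
  bilinear_for *:%R *:%R (fun a b : C => a * b).
Proof.
split=> c a x y /=.
- by rewrite mulrDl; congr (_ + _); rewrite -pzscalerAl.
- by rewrite mulrDr; congr (_ + _); rewrite -pzscalerAr.
Qed.

Definition tmul : A ⊗ B -> A ⊗ B -> A ⊗ B :=
  tmap2 (fun a b : A => a * b) (fun a b : B => a * b).
Definition tone : A ⊗ B := tens (1 : A) (1 : B).

Let mulP : bilinear_for *:%R *:%R tmul.
Proof. by apply: tmap2_bilinear; apply: pzmul_bilinear. Qed.

Lemma tmulE (a a' : A) (b b' : B) :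
  tmul (tens a b) (tens a' b') = tens (a * a') (b * b').
Proof. by apply: tmap2E; apply: pzmul_bilinear. Qed.

Let mull y : linear (tmul^~ y). Proof. by move=> a x z; apply: mulP.1. Qed.
Let mulr x : linear (tmul x). Proof. by move=> a y z; apply: mulP.2. Qed.

Lemma tmulDl : left_distributive tmul +%R.
Proof. by move=> x y z; rewrite -[x]scale1r mull !scale1r. Qed.

Lemma tmulDr : right_distributive tmul +%R.
Proof. by move=> x y z; rewrite -[y]scale1r mulr !scale1r. Qed.

Lemma tmulA : associative tmul.
Proof.
move=> x y z.
apply: (@tens_ext _ _ _ _ (fun x => tmul x (tmul y z))
  (fun x => tmul (tmul x y) z)) x => [a u v|a u v|a b]; rewrite ?mull //.
apply: (@tens_ext _ _ _ _ (fun y => tmul _ (tmul y z))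
  (fun y => tmul (tmul _ y) z)) y => [c u v|c u v|c d]; rewrite ?mull ?mulr ?mull //.
apply: (@tens_ext _ _ _ _ (fun z => tmul _ (tmul _ z))
  (fun z => tmul (tmul _ _) z)) z => [e u v|e u v|e f]; rewrite ?mulr //.
by rewrite !tmulE !mulrA.
Qed.

Lemma tmul1 : left_id tone tmul.
Proof.
move=> x; apply: (@tens_ext _ _ _ _ (tmul tone) id) x => // a b.
by rewrite tmulE !mul1r.
Qed.

Lemma tmulr1 : right_id tone tmul.
Proof.
move=> x; apply: (@tens_ext _ _ _ _ (tmul^~ tone) id) x => // a b.
by rewrite tmulE !mulr1.
Qed.

HB.instance Definition _ := GRing.Zmodule_isPzRing.Build (A ⊗ B)
  tmulA tmul1 tmulr1 tmulDl tmulDr.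

Definition algm : A ⊗ A -> A := tlift (fun a b : A => a * b).

End TensorAlgebra.

(* Group elements are written additively: i + j, 0 and - i stand for the      *)
(* product, the unit and the inverse in G.  ecast transports along the        *)
(* corresponding identities of G, which hold only propositionally.            *)
Record hopfGCoalgebra (k : fieldType) (G : zmodType) := HopfGCoalgebra {
  hopf_fam :> G -> pzAlgType k;
  hopf_Delta : forall i j,
    {linear hopf_fam (i + j) -> hopf_fam i ⊗ hopf_fam j};
  hopf_counit : {linear hopf_fam 0 -> k^o};
  hopf_S : forall i, {linear hopf_fam i -> hopf_fam (- i)};
  hopf_Delta_alg : forall i j, monoid_morphism (hopf_Delta i j);
  hopf_counit_alg : monoid_morphism hopf_counit;
  hopf_coassoc : forall i j l (x : hopf_fam (i + j + l)),
    tassoc (tmap (hopf_Delta i j) idfun (hopf_Delta (i + j) l x)) =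
    tmap idfun (hopf_Delta j l)
      (hopf_Delta i (j + l) (ecast n (hopf_fam n) (esym (addrA i j l)) x));
  hopf_counitr : forall i (x : hopf_fam (i + 0)),
    trunit (tmap idfun hopf_counit (hopf_Delta i 0 x)) =
    ecast n (hopf_fam n) (addr0 i) x;
  hopf_counitl : forall i (x : hopf_fam (0 + i)),
    tlunit (tmap hopf_counit idfun (hopf_Delta 0 i x)) =
    ecast n (hopf_fam n) (add0r i) x;
  hopf_antipodel : forall i (x : hopf_fam 0),
    algm (tmap
      (fun y => ecast n (hopf_fam n) (opprK i) (hopf_S (- i) y)) idfun
      (hopf_Delta (- i) i (ecast n (hopf_fam n) (esym (addNr i)) x))) =
    (hopf_counit x : k) *: (1 : hopf_fam i);
  hopf_antipoder : forall i (x : hopf_fam 0),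
    algm (tmap idfun
      (fun y => ecast n (hopf_fam n) (opprK i) (hopf_S (- i) y))
      (hopf_Delta i (- i) (ecast n (hopf_fam n) (esym (addrN i)) x))) =
    (hopf_counit x : k) *: (1 : hopf_fam i)
}.

Definition hopf_commutative (k : fieldType) (G : zmodType)
    (H : hopfGCoalgebra k G) :=
  forall i (x y : H i), x * y = y * x.

Definition bijective_antipode (k : fieldType) (G : zmodType)
    (H : hopfGCoalgebra k G) :=
  forall i, bijective (hopf_S H i).

Section Comodules.
Variables (k : fieldType) (G : zmodType) (H : hopfGCoalgebra k G).

Record comodule_on (M : G -> lmodType k) := ComoduleOn {
  coact :> forall i j, {linear M (i + j) -> M i ⊗ H j};
  coact_coassoc : forall i j l (x : M (i + j + l)),
    tmap idfun (hopf_Delta H j l)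
      (coact i (j + l) (ecast n (M n) (esym (addrA i j l)) x)) =
    tassoc (tmap (coact i j) idfun (coact (i + j) l x));
  coact_counit : forall i (x : M (i + 0)),
    trunit (tmap idfun (hopf_counit H) (coact i 0 x)) =
    ecast n (M n) (addr0 i) x
}.

Definition famhom (M N : G -> lmodType k) := forall i, {linear M i -> N i}.

Definition colinear (M N : G -> lmodType k) (rM : comodule_on M)
    (rN : comodule_on N) (f : famhom M N) :=
  forall i j (x : M (i + j)),
    rN i j (f (i + j) x) = tmap (f i) idfun (rM i j x).

Definition hopf_comodule : comodule_on (fun i => H i) :=
  @ComoduleOn (fun i => H i) (hopf_Delta H)
    (fun i j l x => esym (hopf_coassoc x)) (@hopf_counitr _ _ H).

Record comodulePoissonAlg := ComodulePoissonAlg {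
  cpa_fam :> G -> poissonAlgType k;
  cpa_coact : comodule_on (fun i => cpa_fam i);
  cpa_coact_alg : forall i j, monoid_morphism (cpa_coact i j);
  cpa_coact_lie : forall i j (a b : cpa_fam (i + j)),
    cpa_coact i j (lie _ a b) =
    tmap2 (lie (cpa_fam i)) (fun x y : H j => x * y)
      (cpa_coact i j a) (cpa_coact i j b)
}.

End Comodules.

Section Modules.
Variables (k : fieldType) (G : zmodType) (H : hopfGCoalgebra k G).
Variable A : comodulePoissonAlg H.

(* rho (op a m) = op a_0 m_0 (x) a_1 m_1 for an action op of A on M.          *)
Definition coact_compatible (M : G -> lmodType k)
    (op : forall i, {bilinear A i -> M i -> M i}) (rho : comodule_on H M) :=
  forall i j (a : A (i + j)) (m : M (i + j)),
    rho i j (op _ a m) =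
    tmap2 (op i) (fun x y : H j => x * y) (cpa_coact A i j a) (rho i j m).

Record lieModule := LieModule {
  lmod_fam :> G -> lmodType k;
  dia : forall i, {bilinear A i -> lmod_fam i -> lmod_fam i};
  dia_lie : forall i (a b : A i) (m : lmod_fam i),
    dia i (lie _ a b) m = dia i a (dia i b m) - dia i b (dia i a m)
}.

Record poissonModule := PoissonModule {
  pmod_lie :> lieModule;
  dot : forall i, {bilinear A i -> pmod_lie i -> pmod_lie i};
  dot1 : forall i (m : pmod_lie i), dot i 1 m = m;
  dotA : forall i (a b : A i) (m : pmod_lie i),
    dot i (a * b) m = dot i a (dot i b m);
  dia_dot : forall i (a b : A i) (m : pmod_lie i),
    dia pmod_lie i a (dot i b m) =
    dot i (lie _ a b) m + dot i b (dia pmod_lie i a m);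
  dia_mul : forall i (a b : A i) (m : pmod_lie i),
    dia pmod_lie i (a * b) m =
    dot i a (dia pmod_lie i b m) + dot i b (dia pmod_lie i a m)
}.

(* (\underline{A}, H)-comodules.                                              *)
Record lieComodule := LieComodule {
  lcom_lie :> lieModule;
  lcom_coact : comodule_on H lcom_lie;
  lcom_dia : coact_compatible (dia lcom_lie) lcom_coact
}.

Record hopfModule := HopfModule {
  hmod_poisson :> poissonModule;
  hmod_coact : comodule_on H hmod_poisson;
  hmod_dia : coact_compatible (dia hmod_poisson) hmod_coact;
  hmod_dot : coact_compatible (dot hmod_poisson) hmod_coact
}.

Definition hmod_lieComodule (M : hopfModule) : lieComodule :=
  LieComodule (@hmod_dia M).

Definition lie_linear (M N : lieModule) (f : famhom M N) :=
  forall i (a : A i) (m : M i), f i (dia M i a m) = dia N i a (f i m).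

Definition dot_linear (M N : poissonModule) (f : famhom M N) :=
  forall i (a : A i) (m : M i), f i (dot M i a m) = dot N i a (f i m).

End Modules.

(* A category whose objects are families of vector spaces with structure and  *)
(* whose morphisms are the families of linear maps preserving it.             *)
Record famCategory (k : fieldType) (G : zmodType) := FamCategory {
  fobj : Type;
  ffam : fobj -> G -> lmodType k;
  fhom : forall X Y, famhom (ffam X) (ffam Y) -> Prop;
  fhom_id : forall X, @fhom X X (fun i => idfun);
  fhom_comp : forall X Y Z (g : famhom (ffam Y) (ffam Z))
    (f : famhom (ffam X) (ffam Y)),
    fhom g -> fhom f -> @fhom X Z (fun i => g i \o f i)
}.

Section Injective.
Variables (k : fieldType) (G : zmodType) (C : famCategory k G).
Local Notation F := (@ffam _ _ C).

Definition monomorphism (X Y : fobj C) (u : famhom (F X) (F Y)) :=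
  fhom u /\
  forall (Z : fobj C) (g h : famhom (F Z) (F X)), fhom g -> fhom h ->
    (forall i z, u i (g i z) = u i (h i z)) -> forall i z, g i z = h i z.

Definition injective_object (M : fobj C) :=
  forall (X Y : fobj C) (u : famhom (F X) (F Y)) (f : famhom (F X) (F M)),
    monomorphism u -> fhom f ->
    exists2 g : famhom (F Y) (F M), fhom g &
      forall i x, g i (u i x) = f i x.

End Injective.

Section Categories.
Variables (k : fieldType) (G : zmodType) (H : hopfGCoalgebra k G).
Variable A : comodulePoissonAlg H.

Lemma colinear_id (M : G -> lmodType k) (rM : comodule_on H M) :
  colinear rM rM (fun i => idfun).
Proof.
move=> i j x; rewrite /=.
by apply: (@tens_ext _ _ _ _ id (tmap idfun idfun)) => // [|v w];
  [apply: tmap_linear | rewrite tmapE].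
Qed.

Lemma colinear_comp (M N P : G -> lmodType k) (rM : comodule_on H M)
    (rN : comodule_on H N) (rP : comodule_on H P)
    (g : famhom N P) (f : famhom M N) :
  colinear rN rP g -> colinear rM rN f ->
  colinear rM rP (fun i => g i \o f i).
Proof.
move=> cg cf i j x; rewrite /= cg cf.
have lf := linearP (f i); have lg := linearP (g i).
apply: (@tens_ext _ _ _ _ (fun y => tmap (g i) idfun (tmap (f i) idfun y))
  (tmap (g i \o f i) idfun)) => [a u v||v w].
- by rewrite !tmap_linear.
- by apply: tmap_linear => // a u v; rewrite /= lf lg.
- by rewrite !tmapE // => a u u'; rewrite /= lf lg.
Qed.

Local Obligation Tactic := idtac.

Program Definition lieModuleCat : famCategory k G :=
  @FamCategory k G (lieModule A) (@lmod_fam _ _ _ A) (@lie_linear _ _ _ A) _ _.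
Next Obligation. by []. Qed.
Next Obligation. by move=> X Y Z g f hg hf i a m; rewrite /= hf hg. Qed.

Program Definition poissonModuleCat : famCategory k G :=
  @FamCategory k G (poissonModule A) (@pmod_lie _ _ _ A)
    (fun M N f => lie_linear f /\ dot_linear f) _ _.
Next Obligation. by []. Qed.
Next Obligation.
by move=> X Y Z g f [hg gd] [hf fd]; split=> i a m; rewrite /= ?hf ?hg ?fd ?gd.
Qed.

Program Definition lieComoduleCat : famCategory k G :=
  @FamCategory k G (lieComodule A) (@lcom_lie _ _ _ A)
    (fun M N f => lie_linear f /\ colinear (lcom_coact M) (lcom_coact N) f) _ _.
Next Obligation. by move=> X; split=> //; apply: colinear_id. Qed.
Next Obligation.
move=> X Y Z g f [hg gc] [hf fc]; split=> [i a m|]; first by rewrite /= hf hg.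
exact: colinear_comp gc fc.
Qed.

Program Definition hopfModuleCat : famCategory k G :=
  @FamCategory k G (hopfModule A) (@hmod_poisson _ _ _ A)
    (fun M N f => [/\ dot_linear f, lie_linear f &
      colinear (hmod_coact M) (hmod_coact N) f]) _ _.
Next Obligation. by move=> X; split=> //; apply: colinear_id. Qed.
Next Obligation.
move=> X Y Z g f [gd hg gc] [fd hf fc].
split=> [i a m|i a m|]; try by rewrite /= ?hf ?hg ?fd ?gd.
exact: colinear_comp gc fc.
Qed.

End Categories.

(* Main.v *)
(* Given a monomorphism u : X -> Y and a morphism f : X -> M, injectivity of M
   without coaction yields g : Y -> M, linear for A but not H-colinear, with
   g u = f.  It is made colinear by averaging over the total integral phi:
     y |-> phi(y_1 S^{-1}(g(y_0)_1)) . g(y_0)_0,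
   where y_0 ⊗ y_1 lies in Y_0 ⊗ H_i and g(y_0)_0 ⊗ g(y_0)_1 in M_i ⊗ H_{-i}.
   With twist(m ⊗ h) = phi(h S^{-1}(m_1)) . m_0, all needed properties of this
   map are checked on tensors m_0 ⊗ h m_1, where twist(m_0 ⊗ h m_1) = phi(h) . m;
   these exhaust M_0 ⊗ H_i.  Compatibility with the actions uses that phi(h)
   commutes with them, phi being central, and that a_1 h = h a_1 either in H or
   after applying phi.
   A monomorphism u is injective because, k being a field, ker u ⊗ H is the
   kernel of u ⊗ id, so that ker u is a subobject of X. *)
Require Import Defs.
From HB Require Import structures.
From mathcomp Require Import all_boot all_order all_algebra.
From mathcomp Require Import boolp classical_sets.

Set Implicit Arguments.
Unset Strict Implicit.
Unset Printing Implicit Defensive.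

Import GRing.Theory.
Local Open Scope ring_scope.

(* Sweedler's notation: the image of t under the map a ⊗ b |-> E, which is
   meaningful when E is bilinear in a and b. *)
Notation "\sw_ ( a ⊗ b <- t ) E" := (tlift (fun a b => E) t)
  (at level 41, a binder, b binder, t at level 35, E at level 41,
   format "'[' \sw_ ( a  ⊗  b  <-  t ) '/  '  E ']'") : ring_scope.

(** * Sweedler calculus *)

Section Linearity.
Variable k : fieldType.
Implicit Types U V W X : lmodType k.

(** A constant of its own, so that the tactic [lin] can match goals syntactically by the shape of
    the function body. *)
Definition lin U V (f : U -> V) := linear f.

Lemma lin_id V : lin (fun x : V => x). Proof. by []. Qed.

Lemma lin_app U V W (f : {linear V -> W}) (E : U -> V) :
  lin E -> lin (fun x => f (E x)).
Proof. by move=> lE a x y; rewrite lE linearP. Qed.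

Lemma lin_comp U V W (f : V -> W) (E : U -> V) :
  lin f -> lin E -> lin (fun x => f (E x)).
Proof. by move=> lf lE a x y; rewrite lE lf. Qed.

Lemma lin_bil_l U V W X (f : {bilinear V -> W -> X}) (E : U -> V) w :
  lin E -> lin (fun x => f (E x) w).
Proof. by move=> lE a x y; rewrite lE linearPl. Qed.

Lemma lin_bil_r U V W X (f : {bilinear V -> W -> X}) (E : U -> W) v :
  lin E -> lin (fun x => f v (E x)).
Proof. by move=> lE a x y; rewrite lE linearPr. Qed.

Lemma lin_tens_l U V W (E : U -> V) (w : W) :
  lin E -> lin (fun x => tens (E x) w).
Proof. by move=> lE a x y; rewrite lE tensl. Qed.

Lemma lin_tens_r U V W (E : U -> W) (v : V) :
  lin E -> lin (fun x => tens v (E x)).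
Proof. by move=> lE a x y; rewrite lE tensr. Qed.

Lemma lin_mul_l U (C : pzAlgType k) (E : U -> C) (c : C) :
  lin E -> lin (fun x => E x * c).
Proof. by move=> lE a x y; rewrite lE (pzmul_bilinear C).1. Qed.

Lemma lin_mul_r U (C : pzAlgType k) (E : U -> C) (c : C) :
  lin E -> lin (fun x => c * E x).
Proof. by move=> lE a x y; rewrite lE (pzmul_bilinear C).2. Qed.

Lemma lin_scale U V (c : k) (E : U -> V) : lin E -> lin (fun x => c *: E x).
Proof. by move=> lE a x y; rewrite lE scalerDr !scalerA mulrC. Qed.

Lemma lin_scalar U V (E : U -> k^o) (v : V) :
  lin E -> lin (fun x => (E x : k) *: v).
Proof. by move=> lE a x y; rewrite lE scalerDl scalerA. Qed.

Lemma lin_tlift U V W X (t : U -> V -> W -> X) (y : V ⊗ W) :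
  (forall v w, lin (fun x => t x v w)) ->
  lin (fun x => \sw_(v ⊗ w <- y) t x v w).
Proof.
by move=> lt a x z; rewrite -tlift_comb; apply: eq_tlift => v w; apply: lt.
Qed.

Lemma lin_tlift_arg U V W X (t : V -> W -> X) (E : U -> V ⊗ W) :
  (forall w, lin (t^~ w)) -> (forall v, lin (t v)) -> lin E ->
  lin (fun x => \sw_(v ⊗ w <- E x) t v w).
Proof. by move=> l1 l2 lE a x y; rewrite lE tlift_linear. Qed.

End Linearity.

(** Structural recursion on the body of the function. Linearity facts in the context, such as those
    on [twist] below, act as further rules; the last branch eta-expands partial applications. *)
Ltac lin := repeat (intros; cbv beta; first
 [ assumption
 | match goal with H : forall _, _ |- lin _ => solve [apply H] end
 | match goal with
   | H : lin ?f |- lin (fun x => ?f (@?E x)) => refine (lin_comp H _)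
   | |- lin (fun x => x) => exact (@lin_id _ _)
   | |- lin (fun x => tlift (@?t x) ?y) => refine (lin_tlift (t := t) y _)
   | |- lin (fun x => tlift ?t (@?E x)) =>
     refine (lin_tlift_arg (t := t) (E := E) _ _ _)
   | |- lin (fun x => tens (@?E x) ?w) => refine (lin_tens_l _ _)
   | |- lin (fun x => tens ?v (@?E x)) => refine (lin_tens_r _ _)
   | |- lin (fun x => GRing.mul (@?E x) ?c) => refine (lin_mul_l _ _)
   | |- lin (fun x => GRing.mul ?c (@?E x)) => refine (lin_mul_r _ _)
   | |- lin (fun x => GRing.scale ?c (@?E x)) => refine (lin_scale _ _)
   | |- lin (fun x => GRing.scale (@?E x) ?c) => refine (lin_scalar (E := E) c _)
   end
 | match goal with
   | H : forall _, lin _ |- _ => refine (lin_comp (H _) _)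
   | H : forall _ _, lin _ |- _ => refine (lin_comp (H _ _) _)
   end
 | refine (lin_bil_l _ _ _) | refine (lin_bil_r _ _ _)
 | refine (lin_app _ _)
 | lazymatch goal with
   | |- lin (fun _ => _) => fail
   | |- lin (?f ?a) => change (lin (fun x => f a x))
   end ]).

Section Sweedler.
Variable k : fieldType.
Implicit Types U V W X Y : lmodType k.

Lemma lin_Z V W (f : V -> W) c x : lin f -> f (c *: x) = c *: f x.
Proof.
move=> lf; pose F := GRing.isLinear.Build k V W *:%R f lf.
pose f' : {linear V -> W} := HB.pack f F.
exact: (linearZ_LR f').
Qed.

(** [tlift] is a finite sum over a representative of [z], so [f] passes through it term by term, for
    any [t]. *)
Lemma sw_lin V W X Y (f : X -> Y) (t : V -> W -> X) z :
  lin f -> f (\sw_(v ⊗ w <- z) t v w) = \sw_(v ⊗ w <- z) f (t v w).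
Proof.
move=> lf; pose F := GRing.isLinear.Build k X Y *:%R f lf.
pose f' : {linear X -> Y} := HB.pack f F.
by rewrite -[f]/(f' : _ -> _) /tlift raddf_sum.
Qed.

Lemma sw_tens V W (z : V ⊗ W) : \sw_(v ⊗ w <- z) tens v w = z.
Proof. by rewrite [RHS]tens_sum. Qed.

Lemma swE V W X (t : V -> W -> X) v w :
  (forall w, lin (t^~ w)) -> (forall v, lin (t v)) ->
  \sw_(v ⊗ w <- tens v w) t v w = t v w.
Proof. by move=> l1 l2; rewrite tliftE. Qed.

Lemma sw_exchange V W V' W' X (t : V -> W -> V' -> W' -> X) z z' :
  \sw_(v ⊗ w <- z) \sw_(v' ⊗ w' <- z') t v w v' w' =
  \sw_(v' ⊗ w' <- z') \sw_(v ⊗ w <- z) t v w v' w'.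
Proof. exact: exchange_big. Qed.

Lemma sw_sw V W V' W' X (t : V -> W -> X) (s : V' -> W' -> V ⊗ W) z :
  (forall w, lin (t^~ w)) -> (forall v, lin (t v)) ->
  \sw_(v ⊗ w <- \sw_(v' ⊗ w' <- z) s v' w') t v w =
  \sw_(v' ⊗ w' <- z) \sw_(v ⊗ w <- s v' w') t v w.
Proof. move=> l1 l2; rewrite (sw_lin (f := tlift t)) //.
exact: (lin_tlift_arg l1 l2 (@lin_id _ _)). Qed.

Lemma sw_tmap V W V' W' X (f : {linear V -> V'}) (g : {linear W -> W'})
    (t : V' -> W' -> X) z :
  (forall w, lin (t^~ w)) -> (forall v, lin (t v)) ->
  \sw_(v ⊗ w <- tmap f g z) t v w = \sw_(v ⊗ w <- z) t (f v) (g w).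
Proof.
move=> l1 l2; rewrite /tmap sw_sw //.
by apply: eq_tlift => v w; rewrite swE.
Qed.

Lemma sw_tmap2 (C : pzAlgType k) V W X Y (f : {bilinear V -> W -> X})
    (t : X -> C -> Y) z z' :
  (forall w, lin (t^~ w)) -> (forall v, lin (t v)) ->
  \sw_(x ⊗ c <- tmap2 f (fun c d : C => c * d) z z') t x c =
  \sw_(v ⊗ (c : C) <- z) \sw_(w ⊗ (d : C) <- z') t (f v w) (c * d).
Proof.
move=> l1 l2; rewrite /tmap2 sw_sw //; apply: eq_tlift => v c.
by rewrite sw_sw //; apply: eq_tlift => w d; rewrite swE.
Qed.

Lemma sw_mul (B C : pzAlgType k) Y (t : B -> C -> Y) (z z' : B ⊗ C) :
  (forall w, lin (t^~ w)) -> (forall v, lin (t v)) ->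
  \sw_(x ⊗ c <- z * z') t x c =
  \sw_((b : B) ⊗ (c : C) <- z) \sw_((b' : B) ⊗ (c' : C) <- z')
    t (b * b') (c * c').
Proof.
move=> l1 l2; rewrite -[z * z']/(tmul z z') /tmul /tmap2 sw_sw //.
apply: eq_tlift => v c.
by rewrite sw_sw //; apply: eq_tlift => w d; rewrite swE.
Qed.

Lemma sw_tassoc U V W X (t : U -> V ⊗ W -> X) (z : U ⊗ V ⊗ W) :
  (forall w, lin (t^~ w)) -> (forall v, lin (t v)) ->
  \sw_(u ⊗ y <- tassoc z) t u y =
  \sw_(x ⊗ w <- z) \sw_(u ⊗ v <- x) t u (tens v w).
Proof.
move=> l1 l2; rewrite /tassoc sw_sw //; apply: eq_tlift => x w.
by rewrite sw_sw //; apply: eq_tlift => u v; rewrite swE.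
Qed.

End Sweedler.

(** * Coassociativity and counit at indices given up to equations in G *)

Section Graded.
Variables (k : fieldType) (G : zmodType) (H : hopfGCoalgebra k G).

Section Coaction.
Variables (M : G -> lmodType k) (rho : comodule_on H M).

(* The coaction rho_{i,j}, with the equation i + j = n as a parameter, so that
   no transport appears in formulas. *)
Definition co i j n (e : i + j = n) : {linear M n -> M i ⊗ H j} :=
  let: erefl := e in rho i j.

Lemma coE i j (x : M (i + j)) : co (erefl (i + j)) x = rho i j x.
Proof. by []. Qed.

Lemma co_ecast i j n (e : i + j = n) x :
  co e x = rho i j (ecast m (M m) (esym e) x).
Proof. by case: n / e x. Qed.

End Coaction.

Local Notation D := (co (hopf_comodule H)).
Local Notation ε := (hopf_counit H).

Section CoactionTheory.
Variables (M : G -> lmodType k) (rho : comodule_on H M).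

(** Coassociativity paired with a trilinear [t]. With the index equations as arguments it rewrites
    directly at splittings such as 0 = i + (-i). *)
Lemma co_coassoc (X : lmodType k) i j l ij jl n (e1 : i + jl = n)
    (e2 : j + l = jl) (e3 : ij + l = n) (e4 : i + j = ij) (x : M n)
    (t : M i -> H j -> H l -> X) :
  (forall h h', lin (fun m => t m h h')) ->
  (forall m h', lin (fun h => t m h h')) ->
  (forall m h, lin (fun h' => t m h h')) ->
  \sw_(m ⊗ h <- co rho e1 x) \sw_(h1 ⊗ h2 <- D e2 h) t m h1 h2 =
  \sw_(m ⊗ h2 <- co rho e3 x) \sw_(m0 ⊗ h1 <- co rho e4 m) t m0 h1 h2.
Proof.
move=> l1 l2 l3; case: jl / e2 e1; case: ij / e4 e3 => e3.
case: n / e3 x => x e1.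
(* Equality proofs in G are unique, so [e1] may be taken to be the associativity of the axiom. *)
rewrite co_ecast (eq_irrelevance (esym e1) (esym (addrA i j l))).
have /(congr1 (tlift (fun m y => \sw_(h1 ⊗ h2 <- y) t m h1 h2))) :=
  coact_coassoc rho x.
rewrite sw_tmap; [|by lin..].
rewrite sw_tassoc; [|by lin..].
move=> ->; rewrite sw_tmap; [|by lin..].
by apply: eq_tlift => m h; apply: eq_tlift => m' h'; rewrite swE; lin.
Qed.

Lemma co_counit (X : lmodType k) i (e : i + 0 = i) (x : M i) (t : M i -> X) :
  lin t -> \sw_(m ⊗ h <- co rho e x) ((ε h : k) *: t m) = t x.
Proof.
move=> lt; rewrite co_ecast.
have /(congr1 t) := coact_counit rho (ecast m (M m) (esym e) x).
have -> : ecast n (M n) (addr0 i) (ecast m (M m) (esym e) x) = x.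
  rewrite (eq_irrelevance (addr0 i) e); clear.
  by move: (i + 0) e x => n e; case: i / e.
move=> <-; rewrite /trunit (sw_lin _ _ lt) sw_tmap.
- by apply: eq_tlift => m h; rewrite lin_Z.
- by lin.
- by lin.
Qed.
End CoactionTheory.

(** * The antipode is an antihomomorphism *)

Section Antipode.

Lemma D_mul i j n (e : i + j = n) (x y : H n) : D e (x * y) = D e x * D e y.
Proof. by case: n / e x y => x y; apply: (hopf_Delta_alg H i j).2. Qed.

Lemma D_one i j n (e : i + j = n) : D e (1 : H n) = tens (1 : H i) (1 : H j).
Proof. by case: n / e; apply: (hopf_Delta_alg H i j).1. Qed.

Lemma counit_mul (x y : H 0) : (ε (x * y) : k) = (ε x : k) * (ε y : k).
Proof. exact: (hopf_counit_alg H).2. Qed.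

Lemma counit_one : (ε (1 : H 0) : k) = 1.
Proof. exact: (hopf_counit_alg H).1. Qed.

(** The right counit is [co_counit] for H as a comodule over itself; the left one comes from a
    separate axiom of H. *)
Lemma D_counitl (X : lmodType k) i (e : 0 + i = i) (x : H i) (t : H i -> X) :
  lin t -> \sw_(h ⊗ m <- D e x) ((ε h : k) *: t m) = t x.
Proof.
move=> lt; rewrite co_ecast.
have /(congr1 t) := hopf_counitl (ecast m (H m) (esym e) x).
have -> : ecast n (H n) (add0r i) (ecast m (H m) (esym e) x) = x.
  rewrite (eq_irrelevance (add0r i) e); clear.
  by move: (0 + i) e x => n e; case: i / e.
move=> <-; rewrite /tlunit (sw_lin _ _ lt) sw_tmap.
- by apply: eq_tlift => m h; rewrite lin_Z.
- by lin.
- by lin.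
Qed.

(** As in [co], the equation on indices is a parameter; it absorbs the transport along -(-i) = i in
    the antipode axioms. *)
Definition antip i j (s : - i = j) : {linear H i -> H j} :=
  let: erefl := s in hopf_S H i.

Lemma antip_ecast i j (s : - i = j) x :
  antip s x = ecast n (H n) s (hopf_S H i x).
Proof. by case: j / s. Qed.

(** The linear [f] lets the axiom be applied inside longer products. *)
Lemma antipodel (X : lmodType k) i j (e : j + i = 0) (s : - j = i) (x : H 0)
    (f : H i -> X) : lin f ->
  \sw_((a : H j) ⊗ (b : H i) <- D e x) f (antip s a * b) = (ε x : k) *: f 1.
Proof.
have ji : j = - i by rewrite -s opprK.
move=> lf; subst j; rewrite -lin_Z // -hopf_antipodel co_ecast.
rewrite (eq_irrelevance (esym e) (esym (addNr i))).
rewrite [X in tmap X](_ : _ = antip s :> (_ -> _)); last first.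
  apply: functional_extensionality_dep => y.
  by rewrite antip_ecast (eq_irrelevance s (opprK i)).
by rewrite /algm sw_tmap ?(sw_lin _ _ lf); lin.
Qed.

Lemma antipoder (X : lmodType k) i j (e : i + j = 0) (s : - j = i) (x : H 0)
    (f : H i -> X) : lin f ->
  \sw_((a : H i) ⊗ (b : H j) <- D e x) f (a * antip s b) = (ε x : k) *: f 1.
Proof.
have ji : j = - i by rewrite -s opprK.
move=> lf; subst j; rewrite -lin_Z // -hopf_antipoder co_ecast.
rewrite (eq_irrelevance (esym e) (esym (addrN i))).
rewrite [X in tmap _ X](_ : _ = antip s :> (_ -> _)); last first.
  apply: functional_extensionality_dep => y.
  by rewrite antip_ecast (eq_irrelevance s (opprK i)).
by rewrite /algm sw_tmap ?(sw_lin _ _ lf); lin.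
Qed.

Lemma antip_one i j (s : - j = i) : antip s 1 = 1.
Proof.
have e : j + i = 0 by rewrite -s subrr.
have := antipodel e s 1 (@lin_id _ _).
by rewrite D_one swE ?mulr1 ?counit_one ?scale1r; lin.
Qed.

(* S(b)S(a) and S(ab) are both equal to S(a_1 b_1) a_2 b_2 S(b_3) S(a_3). *)
Lemma antip_mul i j (s : - j = i) (a b : H j) :
  antip s (a * b) = antip s b * antip s a.
Proof.
have eij : i + j = 0 by rewrite -s addNr.
have eji : j + i = 0 by rewrite addrC.
pose ar := addr0 j; pose al := add0r j.
transitivity (\sw_((a1 : H j) ⊗ (a' : H 0) <- D ar a)
  \sw_((a2 : H i) ⊗ (a3 : H j) <- D eij a')
  \sw_((b1 : H j) ⊗ (b' : H 0) <- D ar b)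
  \sw_((b2 : H i) ⊗ (b3 : H j) <- D eij b')
  (antip s (a1 * b1) * (a2 * (b2 * antip s b3 * antip s a3)))).
  transitivity (\sw_((a1 : H j) ⊗ (a' : H 0) <- D ar a)
      ((ε a' : k) *: (antip s (a1 * b)))).
    by rewrite (co_counit _ ar a (t := fun a1 : H j => antip s (a1 * b))); lin.
  apply: eq_tlift => a1 a'.
  transitivity (\sw_((a2 : H i) ⊗ (a3 : H j) <- D eij a')
      antip s (a1 * b) * (a2 * antip s a3)).
    rewrite (antipoder eij s a'
      (f := fun z : H i => antip s (a1 * b) * z)) ?mulr1 //.
    by lin.
  apply: eq_tlift => a2 a3.
  transitivity (\sw_((b1 : H j) ⊗ (b' : H 0) <- D ar b)
      ((ε b' : k) *: (antip s (a1 * b1) * (a2 * antip s a3)))).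
    rewrite (co_counit _ ar b
      (t := fun b1 : H j => antip s (a1 * b1) * (a2 * antip s a3))) //.
    by lin.
  apply: eq_tlift => b1 b'.
  rewrite (antipoder eij s b'
    (f := fun z : H i => antip s (a1 * b1) * (a2 * (z * antip s a3)))) ?mul1r //.
  by lin.
(* The middle term is now evaluated from the left: after regrouping, S(a_1 b_1) a_2 b_2 collapses
   first. *)
rewrite (co_coassoc _ ar eij al eji a); [|by lin..].
transitivity (\sw_((a' : H 0) ⊗ (a3 : H j) <- D al a)
  ((ε a' : k) *: (antip s b * antip s a3))); last first.
  by rewrite (D_counitl al a (t := fun z : H j => antip s b * antip s z)) //; lin.
apply: eq_tlift => a' a3.
transitivity (\sw_((b' : H 0) ⊗ (b3 : H j) <- D al b)
  ((ε b' : k) *: ((ε a' : k) *: (antip s b3 * antip s a3)))); last first.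
  rewrite (D_counitl al b
    (t := fun z : H j => (ε a' : k) *: (antip s z * antip s a3))) //.
  by lin.
transitivity (\sw_((a1 : H j) ⊗ (a2 : H i) <- D eji a')
  \sw_((b' : H 0) ⊗ (b3 : H j) <- D al b)
  \sw_((b1 : H j) ⊗ (b2 : H i) <- D eji b')
  (antip s (a1 * b1) * (a2 * b2) * (antip s b3 * antip s a3))).
  apply: eq_tlift => a1 a2.
  rewrite (co_coassoc _ ar eij al eji b); [|by lin..].
  by do 2!apply: eq_tlift => ? ?; rewrite !mulrA.
rewrite sw_exchange; apply: eq_tlift => b' b3.
(* Since Δ is multiplicative, a_1 b_1 ⊗ a_2 b_2 is Δ(a' b'), and the antipode axiom applies to the
   product a' b'. *)
rewrite -(sw_mul (D eji a') (D eji b')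
  (t := fun (c1 : H j) (c2 : H i) =>
    antip s c1 * c2 * (antip s b3 * antip s a3))); [|by lin..].
rewrite -D_mul (antipodel eji s _
  (f := fun z : H i => z * (antip s b3 * antip s a3))); last by lin.
by rewrite counit_mul mul1r scalerA mulrC.
Qed.
End Antipode.
End Graded.

Local Notation D := (co (hopf_comodule _)).
Local Notation ε := (hopf_counit _).

(** * The inverse of the antipode *)

Section AntipodeInverse.
Variables (k : fieldType) (G : zmodType) (H : hopfGCoalgebra k G).
Hypothesis S_bij : bijective_antipode H.

Lemma antip_inv_subproof i :
  exists T : {linear H (- i) -> H i},
    cancel (hopf_S H i) T /\ cancel T (hopf_S H i).
Proof.
have [T TK KT] := S_bij i.
have lT : linear T by move=> a x y; apply: (can_inj TK); rewrite linearP !KT.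
pose L := GRing.isLinear.Build k (H (- i)) (H i) *:%R T lT.
pose T' : {linear H (- i) -> H i} := HB.pack T L.
by exists T'.
Qed.

Definition antip_inv i : {linear H (- i) -> H i} :=
  projT1 (cid (antip_inv_subproof i)).
Local Notation T := antip_inv.

Lemma antip_invK i : cancel (T i) (hopf_S H i).
Proof. by have [] := projT2 (cid (antip_inv_subproof i)). Qed.

Lemma antip_inj i : injective (hopf_S H i).
Proof. exact: bij_inj. Qed.

(** S^{-1}(x_2) x_1 = ε(x) 1: applying the injective antihomomorphism S gives S(x_1) x_2 = ε(x)
    1. *)
Lemma antip_inv_mull (X : lmodType k) i (e : i + - i = 0) (x : H 0)
    (f : H i -> X) : lin f ->
  \sw_((a : H i) ⊗ (b : H (- i)) <- D e x) f (T i b * a) = (ε x : k) *: f 1.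
Proof.
move=> lf; rewrite -(sw_lin (fun a b => T i b * a)) // -lin_Z //; congr f.
apply: antip_inj; rewrite linearZ_LR.
rewrite (@antip_one _ _ H (- i) i erefl) -[hopf_S H i]/(antip H erefl).
rewrite (sw_lin (fun a b => T i b * a)); last by lin.
rewrite -(antipodel e erefl x (f := fun z : H (- i) => z)) //.
by apply: eq_tlift => a b; rewrite antip_mul [antip _ _ (T _ _)]antip_invK.
Qed.

(** x_2 S^{-1}(x_1) = ε(x) 1: applying S gives x_1 S(x_2) = ε(x) 1. *)
Lemma antip_inv_mulr (X : lmodType k) i (e : - i + i = 0) (x : H 0)
    (f : H i -> X) : lin f ->
  \sw_((a : H (- i)) ⊗ (b : H i) <- D e x) f (b * T i a) = (ε x : k) *: f 1.
Proof.
move=> lf; rewrite -(sw_lin (fun a (b : H i) => b * T i a)) // -lin_Z //.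
congr f.
apply: antip_inj; rewrite linearZ_LR.
rewrite (@antip_one _ _ H (- i) i erefl) -[hopf_S H i]/(antip H erefl).
rewrite (sw_lin (fun a (b : H i) => b * T i a)); last by lin.
rewrite -(antipoder e erefl x (f := fun z : H (- i) => z)) //.
by apply: eq_tlift => a b; rewrite antip_mul [antip _ _ (T _ _)]antip_invK.
Qed.
End AntipodeInverse.

Section Colinear.
Variables (k : fieldType) (G : zmodType) (H : hopfGCoalgebra k G).

Lemma sw_colinear (M N : G -> lmodType k) (rM : comodule_on H M)
    (rN : comodule_on H N) (f : famhom M N) (X : lmodType k) i j n
    (e : i + j = n) (x : M n) (t : N i -> H j -> X) :
  colinear rM rN f -> (forall h, lin (t^~ h)) -> (forall m, lin (t m)) ->
  \sw_(m ⊗ h <- co rN e (f n x)) t m h =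
  \sw_(m ⊗ h <- co rM e x) t (f i m) h.
Proof. by move=> cf l1 l2; case: n / e x => x /=; rewrite cf sw_tmap. Qed.

Variable A : comodulePoissonAlg H.

Lemma co_compatible (M : G -> lmodType k)
    (op : forall i, {bilinear A i -> M i -> M i}) (rho : comodule_on H M)
    i j n (e : i + j = n) (a : A n) (m : M n) :
  coact_compatible op rho ->
  co rho e (op n a m) =
  tmap2 (op i) (fun x y : H j => x * y) (co (cpa_coact A) e a) (co rho e m).
Proof. by move=> c; case: n / e a m => a m; apply: c. Qed.
End Colinear.

(** * Averaging a linear map over a total integral *)

Section Integral.
Variables (k : fieldType) (G : zmodType) (H : hopfGCoalgebra k G).
Hypothesis S_bij : bijective_antipode H.
Variable A : comodulePoissonAlg H.
Variable phi : famhom (fun i : G => H i) (fun i : G => A i).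
Hypothesis phi_colinear : colinear (hopf_comodule H) (cpa_coact A) phi.
Hypothesis phi_unit : forall i, phi i 1 = 1.
Variable M : hopfModule A.

Local Notation T := (antip_inv S_bij).
Local Notation ρ := (co (hmod_coact M)).
Local Notation ρA := (co (cpa_coact A)).

Definition twist i (m : M 0) (h : H i) : M i :=
  \sw_((m0 : M i) ⊗ (c : H (- i)) <- ρ (addrN i) m)
    dot M i (phi i (h * T i c)) m0.

Lemma twist_linl i (h : H i) : lin (fun m => twist m h).
Proof. rewrite /twist; lin. Qed.

Lemma twist_linr i (m : M 0) : lin (fun h : H i => twist m h).
Proof. rewrite /twist; lin. Qed.

(** By coassociativity the left side is phi(h m_2 S^{-1}(m_1)) . m_0, where m_2 S^{-1}(m_1)
    collapses to ε(m_1). *)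
Lemma twist_coact i (e : 0 + i = i) (m : M i) (h : H i) :
  \sw_((m0 : M 0) ⊗ (c : H i) <- ρ e m) twist m0 (h * c) =
  dot M i (phi i h) m.
Proof.
rewrite /twist -(co_coassoc (hmod_coact M) (addr0 i) (addNr i) e (addrN i) m
  (t := fun (m0 : M i) (c : H (- i)) (d : H i) =>
    dot M i (phi i (h * d * T i c)) m0)); [|by lin..].
transitivity (\sw_((m0 : M i) ⊗ (c : H 0) <- ρ (addr0 i) m)
    ((ε c : k) *: (dot M i (phi i h) m0))); last first.
  by rewrite (co_counit (hmod_coact M) (addr0 i) m
    (t := fun m0 : M i => dot M i (phi i h) m0)); lin.
apply: eq_tlift => m0 c; rewrite -[h in RHS]mulr1.
rewrite -(antip_inv_mulr S_bij (addNr i) c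
  (f := fun z : H i => dot M i (phi i (h * z)) m0)); last by lin.
by apply: eq_tlift => ? ?; rewrite mulrA.
Qed.

(* The map m ⊗ h |-> m_0 ⊗ h m_1 from M_i ⊗ H_i to M_0 ⊗ H_i is surjective: a
   right inverse is m ⊗ h |-> m_0 ⊗ h S^{-1}(m_1). *)
Lemma twist_ext (X : lmodType k) i (B B' : M 0 -> H i -> X) :
  (forall h, lin (B^~ h)) -> (forall m, lin (B m)) ->
  (forall h, lin (B'^~ h)) -> (forall m, lin (B' m)) ->
  (forall (m : M i) (h : H i),
    \sw_((m0 : M 0) ⊗ (c : H i) <- ρ (add0r i) m) B m0 (h * c) =
    \sw_((m0 : M 0) ⊗ (c : H i) <- ρ (add0r i) m) B' m0 (h * c)) ->
  forall m h, B m h = B' m h.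
Proof.
move=> l1 l2 l1' l2' BB' m h.
(* [E] expresses m ⊗ h as the image of m_0 ⊗ h S^{-1}(m_1), so the hypothesis applies to each
   summand. It follows from S^{-1}(m_2) m_1 = ε(m_1) 1. *)
suff E (C : M 0 -> H i -> X) : (forall h, lin (C^~ h)) ->
    (forall m, lin (C m)) ->
    C m h = \sw_((m0 : M i) ⊗ (c : H (- i)) <- ρ (addrN i) m)
      \sw_((m00 : M 0) ⊗ (d : H i) <- ρ (add0r i) m0) C m00 (h * T i c * d).
  by rewrite (E B) // (E B') //; apply: eq_tlift => m0 c; apply: BB'.
move=> {BB' B B' l1 l2 l1' l2'} l1 l2.
rewrite -(co_coassoc (hmod_coact M) (addr0 0) (addrN i) (addrN i) (add0r i) m
  (t := fun (m0 : M 0) (d : H i) (c : H (- i)) => C m0 (h * T i c * d)));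
  [|by lin..].
transitivity (\sw_((m0 : M 0) ⊗ (c : H 0) <- ρ (addr0 0) m)
    ((ε c : k) *: C m0 h)).
  by rewrite (co_counit (hmod_coact M) (addr0 0) m (t := C^~ h)).
apply: eq_tlift => m0 c; rewrite -[h in LHS]mulr1.
rewrite -(antip_inv_mull S_bij (addrN i) c
  (f := fun z : H i => C m0 (h * z))); last by lin.
by apply: eq_tlift => ? ?; rewrite mulrA.
Qed.

(** On m_0 ⊗ h m_1 both sides equal phi(h_1) . m_0 ⊗ h_2 m_1: the left by colinearity of phi, the
    right by multiplicativity of Δ and coassociativity. *)
Lemma twist_colinear i j n (e : i + j = n) (m : M 0) (h : H n) :
  ρ e (twist m h) =
  \sw_((h1 : H i) ⊗ (h2 : H j) <- D e h) tens (twist m h1) h2.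
Proof.
apply: (twist_ext (B := fun m (h : H n) => ρ e (twist m h))
  (B' := fun m (h : H n) =>
    \sw_((h1 : H i) ⊗ (h2 : H j) <- D e h) tens (twist m h1) h2)) => {m h}.
- by move=> h; have := twist_linl h; lin.
- by move=> m; have := @twist_linr n m; lin.
- by move=> h; have := @twist_linl i; lin.
- by move=> m; have := @twist_linr i; lin.
move=> m h.
have l1 := @twist_linl; have l2 := @twist_linr.
rewrite -(sw_lin (f := ρ e)); last exact: linearP.
rewrite twist_coact (co_compatible _ _ _ (@hmod_dot _ _ _ _ M)).
transitivity (\sw_((h1 : H i) ⊗ (h2 : H j) <- D e h)
  \sw_((m0 : M i) ⊗ (c : H j) <- ρ e m)
  tens (dot M i (phi i h1) m0) (h2 * c)).
  rewrite /tmap2 (sw_colinear (rM := hopf_comodule H)) //; by lin.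
symmetry; transitivity (\sw_((m0 : M 0) ⊗ (c : H n) <- ρ (add0r n) m)
  \sw_((h1 : H i) ⊗ (h2 : H j) <- D e h)
  \sw_((c1 : H i) ⊗ (c2 : H j) <- D e c)
  tens (twist m0 (h1 * c1)) (h2 * c2)).
  apply: eq_tlift => m0 c; rewrite D_mul.
  rewrite (sw_mul (D e h) (D e c)
    (t := fun (h1 : H i) (h2 : H j) => tens (twist m0 h1) h2)) //; by lin.
rewrite sw_exchange; apply: eq_tlift => h1 h2.
rewrite (co_coassoc (hmod_coact M) (add0r n) e e (add0r i)); [|by lin..].
apply: eq_tlift => m' c2.
rewrite -(sw_lin (f := fun z : M i => tens z (h2 * c2))); last by lin.
by rewrite twist_coact.
Qed.

Section Action.
(** [op] stands for both [dot M] and [dia M], which share the two properties assumed here. *)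
Variable op : forall i, {bilinear A i -> M i -> M i}.
Hypothesis op_compat : coact_compatible op (hmod_coact M).
Hypothesis op_phi : forall i (a : A i) (x : H i) (m : M i),
  op i a (dot M i (phi i x) m) = dot M i (phi i x) (op i a m).

Let op_tensor i (m : M i) (a : A i) (h : H i) :
  \sw_((a0 : A 0) ⊗ (a1 : H i) <- ρA (add0r i) a)
  \sw_((m0 : M 0) ⊗ (c : H i) <- ρ (add0r i) m)
    twist (op 0 a0 m0) (h * (a1 * c)) = dot M i (phi i h) (op i a m).
Proof.
have l1 := @twist_linl; have l2 := @twist_linr.
rewrite -(twist_coact (add0r i)) (co_compatible _ _ _ op_compat).
by rewrite sw_tmap2; lin.
Qed.

(* H is not commutative here: insert a_0 ⊗ a_1 = a_0 ⊗ a_3 S^{-1}(a_2) a_1, so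
   that a_3 S^{-1}(a_2) can be moved across h after applying phi. *)
Let op_insert i (m : M i) (a : A i) (h : H i) :
  (forall i, GRing.monoid_morphism (phi i)) ->
  \sw_((a0 : A 0) ⊗ (a1 : H i) <- ρA (add0r i) a)
  \sw_((m0 : M 0) ⊗ (c : H i) <- ρ (add0r i) m)
    twist (op 0 a0 m0) (a1 * (h * c)) = dot M i (phi i h) (op i a m).
Proof.
move=> phi_alg.
have l1 := @twist_linl; have l2 := @twist_linr.
(* Here [a1], [b], [d] are a_1, a_2, a_3. Collapsing [T i b * a1] in [F] leaves d h c, the argument
   of [twist] in the statement. *)
pose F (a0 : A 0) (a1 : H i) (b : H (- i)) (d : H i) :=
  \sw_((m0 : M 0) ⊗ (c : H i) <- ρ (add0r i) m)
    twist (op 0 a0 m0) (d * (h * T i b) * (a1 * c)).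
transitivity (\sw_((x : A 0) ⊗ (d : H i) <- ρA (add0r i) a)
  \sw_((a0' : A i) ⊗ (b : H (- i)) <- ρA (addrN i) x)
  \sw_((a0 : A 0) ⊗ (a1 : H i) <- ρA (add0r i) a0') F a0 a1 b d).
  apply: eq_tlift => x d.
  rewrite -(co_coassoc (cpa_coact A) (addr0 0) (addrN i) (addrN i) (add0r i) x
    (t := fun a0 a1 b => F a0 a1 b d)); [|by rewrite /F; lin..].
  transitivity (\sw_((a0 : A 0) ⊗ (y : H 0) <- ρA (addr0 0) x) ((ε y : k) *:
    \sw_((m0 : M 0) ⊗ (c : H i) <- ρ (add0r i) m)
      twist (op 0 a0 m0) (d * (h * c)))).
    by rewrite (co_counit (cpa_coact A) (addr0 0) x (t := fun a0 : A 0 =>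
      \sw_((m0 : M 0) ⊗ (c : H i) <- ρ (add0r i) m)
        twist (op 0 a0 m0) (d * (h * c)))) //; lin.
  apply: eq_tlift => a0 y; rewrite /F sw_exchange.
  rewrite (sw_lin (f := fun z : M i => (ε y : k) *: z)); last by lin.
  apply: eq_tlift => m0 c; rewrite /= -[c in LHS]mul1r.
  rewrite -(antip_inv_mull S_bij (addrN i) y
    (f := fun z : H i => twist (op 0 a0 m0) (d * (h * (z * c))))); last by lin.
  by apply: eq_tlift => ? ?; rewrite !mulrA.
(* Regrouped, a_0 ⊗ a_1 is again a coaction, so [op_tensor] evaluates [F] with d h S^{-1}(b) in
   place of h. *)
rewrite -(co_coassoc (cpa_coact A) (addr0 i) (addNr i) (add0r i) (addrN i) a
  (t := fun (a0' : A i) (b : H (- i)) (d : H i) =>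
  \sw_((a0 : A 0) ⊗ (a1 : H i) <- ρA (add0r i) a0') F a0 a1 b d));
  [|by rewrite /F; lin..].
transitivity (\sw_((a0 : A i) ⊗ (y : H 0) <- ρA (addr0 i) a)
  ((ε y : k) *: dot M i (phi i h) (op i a0 m))); last first.
  by rewrite (co_counit (cpa_coact A) (addr0 i) a
    (t := fun a0 : A i => dot M i (phi i h) (op i a0 m))) //; lin.
apply: eq_tlift => a0 y.
(* The factor [phi i 1] makes room for d S^{-1}(b) = ε(y) 1; commutativity of A_i then brings phi(d)
   and phi(S^{-1}(b)) together. *)
have -> : dot M i (phi i h) (op i a0 m) =
    dot M i (phi i 1 * phi i h) (op i a0 m).
  by rewrite phi_unit mul1r.
rewrite -(antip_inv_mulr S_bij (addNr i) y
  (f := fun z : H i => dot M i (phi i z * phi i h) (op i a0 m))); last by lin.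
apply: eq_tlift => b d; rewrite /F op_tensor.
by rewrite !(phi_alg i).2 -!mulrA [phi i h * _]poisson_mulC.
Qed.

(** By [twist_ext] it suffices to test on m_0 ⊗ h m_1, where the right side is phi(h) . op(a, m).
    The left side is handled by a_1 h = h a_1 and [op_tensor] if H is commutative, and by
    [op_insert] if phi is multiplicative. *)
Lemma twist_act i (a : A i) (m : M 0) (h : H i) :
  hopf_commutative H \/ (forall i, GRing.monoid_morphism (phi i)) ->
  \sw_((a0 : A 0) ⊗ (a1 : H i) <- ρA (add0r i) a) twist (op 0 a0 m) (a1 * h) =
  op i a (twist m h).
Proof.
move=> comm; have l1 := @twist_linl; have l2 := @twist_linr.
apply: (twist_ext (B := fun m (h : H i) =>
    \sw_((a0 : A 0) ⊗ (a1 : H i) <- ρA (add0r i) a) twist (op 0 a0 m) (a1 * h))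
  (B' := fun m (h : H i) => op i a (twist m h))) => {m h}; try by lin.
move=> m h; rewrite -(sw_lin (f := op i a)); last by lin.
rewrite twist_coact op_phi sw_exchange.
case: comm => [comm|phi_alg]; last exact: op_insert.
rewrite -op_tensor; apply: eq_tlift => a0 a1; apply: eq_tlift => m0 c.
by rewrite !mulrA (comm _ a1 h).
Qed.
End Action.

Section Average.
Variables (Y : G -> lmodType k) (rY : comodule_on H Y) (g : famhom Y M).

(** Every degree is computed from [g 0], because y_0 lies in Y_0. *)
Definition average_fun i (y : Y i) : M i :=
  \sw_((y0 : Y 0) ⊗ (h : H i) <- co rY (add0r i) y) twist (g 0 y0) h.

Lemma average_linear i : linear (@average_fun i).
Proof.
have l1 := @twist_linl; have l2 := @twist_linr.
by rewrite -/(lin _) /average_fun; lin.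
Qed.

Definition average : famhom Y M := fun i =>
  HB.pack (@average_fun i) (GRing.isLinear.Build k (Y i) (M i) *:%R _
    (@average_linear i)).

Lemma averageE i (y : Y i) : average i y =
  \sw_((y0 : Y 0) ⊗ (h : H i) <- co rY (add0r i) y) twist (g 0 y0) h.
Proof. by []. Qed.

Lemma average_colinear : colinear rY (hmod_coact M) average.
Proof.
have l1 := @twist_linl; have l2 := @twist_linr.
move=> i j y; rewrite -!coE averageE.
rewrite (sw_lin (f := ρ erefl)); last exact: linearP.
transitivity (\sw_((y0 : Y 0) ⊗ (h : H (i + j)) <- co rY (add0r (i + j)) y)
  \sw_((h1 : H i) ⊗ (h2 : H j) <- D erefl h) tens (twist (g 0 y0) h1) h2).
  by apply: eq_tlift => y0 h; rewrite twist_colinear.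
rewrite (co_coassoc rY (add0r (i + j)) erefl erefl (add0r i) y
  (t := fun y0 (h1 : H i) (h2 : H j) => tens (twist (g 0 y0) h1) h2));
  [|by lin..].
apply: eq_tlift => y0 h.
by rewrite averageE (sw_lin (f := fun z : M i => tens z h)); lin.
Qed.

(** Colinearity of u and f turns the average at u(x) into twist(f(x)_0 ⊗ f(x)_1), which is phi(1) .
    f(x) by [twist_coact]. *)
Lemma average_id (X : G -> lmodType k) (rX : comodule_on H X)
    (u : famhom X Y) (f : famhom X M) :
  colinear rX rY u -> colinear rX (hmod_coact M) f ->
  (forall i x, g i (u i x) = f i x) ->
  forall i x, average i (u i x) = f i x.
Proof.
have l1 := @twist_linl; have l2 := @twist_linr.
move=> cu cf guf i x; rewrite averageE (sw_colinear _ _ cu); [|by lin..].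
rewrite -[f i x](dot1 (p := M)) -(phi_unit i) -(twist_coact (add0r i)).
rewrite (sw_colinear _ _ cf); [|by lin..].
by apply: eq_tlift => x0 h; rewrite guf mul1r.
Qed.

Lemma average_act (opY : forall i, {bilinear A i -> Y i -> Y i})
    (op : forall i, {bilinear A i -> M i -> M i}) :
  coact_compatible opY rY -> coact_compatible op (hmod_coact M) ->
  (forall i (a : A i) (x : H i) (m : M i),
    op i a (dot M i (phi i x) m) = dot M i (phi i x) (op i a m)) ->
  hopf_commutative H \/ (forall i, GRing.monoid_morphism (phi i)) ->
  (forall i (a : A i) y, g i (opY i a y) = op i a (g i y)) ->
  forall i (a : A i) y, average i (opY i a y) = op i a (average i y).
Proof.
have l1 := @twist_linl; have l2 := @twist_linr.
move=> cY cM op_phi comm gop i a y.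
rewrite !averageE (co_compatible _ _ _ cY) sw_tmap2; [|by lin..].
rewrite sw_exchange (sw_lin (f := op i a)); last by lin.
apply: eq_tlift => y0 h; rewrite -twist_act //.
by apply: eq_tlift => a0 a1; rewrite gop.
Qed.
End Average.
End Integral.

(** * Kernels of colinear maps *)

Section Splitting.
Variable k : fieldType.

Definition subspace (V : lmodType k) (C : V -> Prop) :=
  C 0 /\ forall a x y, C x -> C y -> C (a *: x + y).

(** Zorn's lemma on the subspaces that contain [C0] and meet [K] trivially. Prescribing [C0] is what
    permits extending partially defined linear maps. *)
Lemma subspace_complement (V : lmodType k) (K C0 : V -> Prop) :
  subspace K -> subspace C0 -> (forall v, C0 v -> K v -> v = 0) ->
  exists C : V -> Prop, [/\ subspace C, forall v, C0 v -> C v,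
    forall v, C v -> K v -> v = 0 &
    forall v, exists c x, [/\ C c, K x & v = c + x]].
Proof.
move=> sK sC0 C0K.
pose good (C : V -> Prop) := [/\ subspace C, forall v, C0 v -> C v &
  forall v, C v -> K v -> v = 0].
pose T := {C : V -> Prop | good C}.
pose R (s t : T) : bool := `[< forall v, sval s v -> sval t v >].
have [| | |F Ftot|[C gC] Cmax] := @Zorn T R.
- by move=> t; apply/asboolP.
- by move=> r s t /asboolP rs /asboolP st; apply/asboolP => v /rs/st.
- move=> [s gs] [t gt] /asboolP /= st /asboolP /= ts.
  apply: eq_exist; apply/funext => v; apply/propext.
  by split; [apply: st|apply: ts].
(* A chain is bounded by its union; adjoining [C0] covers the empty chain. *)
- pose U v := C0 v \/ exists2 s, F s & sval s v.
  have UF s v : F s -> sval s v -> U v by move=> Fs sv; right; exists s.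
  suff gU : good U.
    by exists (exist _ U gU) => s Fs; apply/asboolP => v /= sv; apply: UF sv.
  split; last 1 first.
  + move=> v [/C0K //|[s Fs sv]].
    by have [_ _ sK'] := svalP s; apply: sK'.
  + split; first by left; apply: sC0.1.
    move=> a x y [C0x|[s Fs sx]] [C0y|[t Ft ty]].
    * by left; apply: sC0.2.
    * have [st C0t _] := svalP t.
      by apply: (UF t) => //; apply: st.2 => //; apply: C0t.
    * have [ss C0s _] := svalP s.
      by apply: (UF s) => //; apply: ss.2 => //; apply: C0s.
    * have [/asboolP sub|/asboolP sub] := Ftot _ _ Fs Ft.
        have [st _ _] := svalP t.
        by apply: (UF t) => //; apply: st.2 => //; apply: sub.
      have [ss _ _] := svalP s.
      by apply: (UF s) => //; apply: ss.2 => //; apply: sub.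
  + by move=> v; left.
have [sC C0C CK] := gC; exists C; split=> // v; apply: contrapT => nv.
(* If v were outside C + K, the larger subspace kv + C would still meet K trivially, against
   maximality. *)
pose C' w := exists a c, C c /\ w = a *: v + c.
have CC' w : C w -> C' w by move=> Cw; exists 0, w; rewrite scale0r add0r.
have gC' : good C'.
  split=> [|w /C0C/CC' //|w [a [c [Cc ->]]] Kw].
    split; first exact/CC'/sC.1.
    move=> b x y [a [c [Cc ->]]] [a' [c' [Cc' ->]]].
    exists (b * a + a'), (b *: c + c'); split; first exact: sC.2.
    by rewrite scalerDr scalerDl scalerA addrACA.
  have [a0|a0] := eqVneq a 0.
    by move: Kw; rewrite a0 scale0r add0r => /(CK _ Cc).
  (* For a ≠ 0, solving a v + c ∈ K for v puts v in C + K; the summands 0 fit the closure condition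
     of [subspace]. *)
  case: nv; exists (- a^-1 *: c + 0), (a^-1 *: (a *: v + c) + 0); split.
  - by apply: sC.2 => //; apply: sC.1.
  - by apply: sK.2 => //; apply: sK.1.
  rewrite !addr0 scalerDr scalerA mulVf // scale1r addrCA -scalerDl addNr.
  by rewrite scale0r addr0.
case: nv; exists v, 0; split; [|exact: sK.1|by rewrite addr0].
have [] : exist good C' gC' = exist _ C gC by apply: Cmax; apply/asboolP.
by move=> <-; exists 1, 0; rewrite scale1r addr0; split=> //; apply: sC.1.
Qed.

(** A generalised inverse: on a complement C of ker u the map u is injective, and the inverse of its
    restriction to C extends to all of W. *)
Lemma linear_pinv (V W : lmodType k) (u : {linear V -> W}) :
  exists s : {linear W -> V}, forall v, u (s (u v)) = u v.
Proof.
have [| |v ->|C [sC _ CK VE]] :=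
  @subspace_complement V (fun v => u v = 0) (fun v => v = 0).
- by split=> [|a x y ux uy]; rewrite ?linear0 // linearP ux uy scaler0 addr0.
- by split=> // a x y -> ->; rewrite scaler0 addr0.
- by [].
(* The extension is found as a graph: a complement of 0 × V in W × V containing all pairs (u(v), v)
   with v in C. *)
have [| |p|Γ [sΓ CΓ ΓK ΓE]] := @subspace_complement (W * V)%type
  (fun p => p.1 = 0) (fun p => C p.2 /\ p.1 = u p.2).
- by split=> // a x y /= -> ->; rewrite scaler0 addr0.
- split=> [|a x y /= [Cx ->] [Cy ->]].
    by split; [apply: sC.1|rewrite [RHS](linear0 u)].
  by split; [apply: sC.2|rewrite linearP].
- by case: p => w v /= [Cv ->] uv; rewrite (CK v) // linear0.
have Γu w v v' : Γ (w, v) -> Γ (w, v') -> v = v'.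
  move=> Γv Γv'; apply/eqP; rewrite -subr_eq0; apply/eqP.
  have : Γ ((-1 : k) *: (w, v') + (w, v)) by apply: sΓ.2.
  move=> /ΓK /=; rewrite scaleN1r addNr => /(_ erefl) [_].
  by rewrite scaleN1r addrC.
have Γex w : exists v, Γ (w, v).
  have [[w1 v1] [[w2 v2] [G1 /= -> [-> _]]]] := ΓE (w, 0).
  by exists v1; rewrite addr0.
pose f w := projT1 (cid (Γex w)).
have fP w : Γ (w, f w) by exact: (projT2 (cid (Γex w))).
have lf : linear f.
  move=> a x y; apply: (Γu _ _ _ (fP _)).
  exact: (sΓ.2 a _ _ (fP x) (fP y)).
pose L := GRing.isLinear.Build k W V *:%R f lf.
pose s : {linear W -> V} := HB.pack f L.
exists s => v; have [c [x [Cc ux ->]]] := VE v.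
rewrite linearD ux addr0; congr (u _).
by apply: (Γu (u c)); [apply: fP|apply: CΓ].
Qed.
End Splitting.

(** * The kernel of a linear map as a vector space, with a projection onto it *)

Section Kernel.
Variables (k : fieldType) (V W : lmodType k) (u : {linear V -> W}).

Definition kerp : {pred V} := [pred x | u x == 0].

Lemma kerp_submod_closed : submod_closed kerp.
Proof.
split=> [|a x y]; rewrite !inE ?linear0 // linearP => /eqP -> /eqP ->.
by rewrite scaler0 addr0.
Qed.
HB.instance Definition _ :=
  GRing.isSubmodClosed.Build k V kerp kerp_submod_closed.

Record kernel := Kernel { kernel_val : V; _ : kernel_val \in kerp }.
HB.instance Definition _ := [isSub for kernel_val].
HB.instance Definition _ := [Choice of kernel by <:].
HB.instance Definition _ := [SubChoice_isSubLmodule of kernel by <:].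

Lemma kernelP (x : kernel) : u (kernel_val x) = 0.
Proof. by have /eqP := valP x. Qed.
End Kernel.

Section KernelProjection.
Variables (k : fieldType) (V W : lmodType k) (u : {linear V -> W}).
Let s := projT1 (cid (linear_pinv u)).

(** Since u s u = u, the map id - s u is a projection onto ker u. *)
Lemma kernel_proj_subproof (x : V) : x - s (u x) \in kerp u.
Proof.
by rewrite inE linearB (projT2 (cid (linear_pinv u))) subrr.
Qed.

Definition kernel_proj_fun (x : V) : kernel u :=
  Kernel (kernel_proj_subproof x).

Lemma kernel_proj_linear : linear kernel_proj_fun.
Proof.
move=> a x y; apply: val_inj; rewrite linearP /= (linearP u) (linearP s).
by rewrite scalerBr opprD addrACA.
Qed.

Definition kernel_proj : {linear V -> kernel u} :=
  HB.pack kernel_proj_fun (GRing.isLinear.Build k V (kernel u) *:%R _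
    kernel_proj_linear).

Definition kernel_inc : {linear kernel u -> V} := val.

Lemma kernel_incK : cancel kernel_inc kernel_proj.
Proof.
move=> x; apply: val_inj => /=.
by rewrite [u _](kernelP x) linear0 subr0.
Qed.

(* Exactness of - ⊗ U at the kernel. *)
Lemma kernel_tens (U : lmodType k) (z : V ⊗ U) :
  tmap u idfun z = 0 -> tmap kernel_inc idfun (tmap kernel_proj idfun z) = z.
Proof.
move=> uz; rewrite {1}/tmap sw_tmap; [|by lin..].
(* Inclusion after projection is id - s u, so the two sides differ by (s ⊗ id)(u ⊗ id)(z) = 0. *)
have su0 : \sw_(v ⊗ h <- z) tens (s (u v)) h = 0.
  transitivity (\sw_(w ⊗ h <- tmap u idfun z) tens (s w) h).
    by rewrite sw_tmap; lin.
  rewrite uz -[0 in LHS](scale0r (0 : W ⊗ U)).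
  rewrite (lin_Z (f := tlift (fun w h => tens (s w) h))) ?scale0r //.
  by apply: tlift_linear; split=> ?; rewrite -/(lin _); lin.
rewrite -[RHS]add0r -[0 in RHS](scaler0 _ (-1 : k)) -su0 -[X in _ + X]sw_tens.
rewrite -tlift_comb; apply: eq_tlift => v h.
by rewrite -tensl scaleN1r addrC.
Qed.
End KernelProjection.

(** * The comodule structure and the actions on the kernel *)

Section KernelComodule.
Variables (k : fieldType) (G : zmodType) (H : hopfGCoalgebra k G).
Variables (M N : G -> lmodType k) (rM : comodule_on H M) (rN : comodule_on H N).
Variable u : famhom M N.
Hypothesis u_colinear : colinear rM rN u.

Definition kernel_fam (i : G) : lmodType k := kernel (u i).
Local Notation K := kernel_fam.

Definition kernel_hom : famhom K M := fun i => kernel_inc (u i).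
Local Notation ι := kernel_hom.

Lemma kernel_hom_inj i : injective (ι i).
Proof. exact: can_inj (@kernel_incK _ _ _ (u i)). Qed.

Lemma kernel_hom0 i x : u i (ι i x) = 0.
Proof. exact: kernelP. Qed.

(** The projection onto the kernel induces a left inverse. Identities in K_i ⊗ U can thus be checked
    in M_i ⊗ U. *)
Lemma kernel_tens_inj i (U : lmodType k) : injective (tmap (ι i) (@idfun U)).
Proof.
apply: (can_inj (g := tmap (kernel_proj (u i)) idfun)) => z.
rewrite {1}/tmap sw_tmap; [|by lin..]; rewrite -[RHS]sw_tens.
by apply: eq_tlift => v w; rewrite [kernel_proj _ _]kernel_incK.
Qed.

Lemma kernel_coact_linear i j :
  linear (fun x => tmap (kernel_proj (u i)) idfun (rM i j (ι (i + j) x))).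
Proof. by rewrite -/(lin _) /tmap; lin. Qed.

(** The projection forces the values into K_i ⊗ H_j; [kernel_coactE] shows that it changes
    nothing. *)
Definition kernel_coact i j : {linear K (i + j) -> K i ⊗ H j} :=
  HB.pack (fun x => tmap (kernel_proj (u i)) idfun (rM i j (ι (i + j) x)))
    (GRing.isLinear.Build k (K (i + j)) (K i ⊗ H j) *:%R _
      (@kernel_coact_linear i j)).

(** By colinearity u ⊗ id kills the coaction of a kernel element, so [kernel_tens] applies. *)
Lemma kernel_coactE i j (x : K (i + j)) :
  tmap (ι i) idfun (kernel_coact i j x) = rM i j (ι (i + j) x).
Proof.
apply: kernel_tens; rewrite -u_colinear kernel_hom0; exact: linear0.
Qed.

Lemma sw_kernel_coact (X : lmodType k) i j (x : K (i + j))
    (t : M i -> H j -> X) :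
  (forall h, lin (t^~ h)) -> (forall m, lin (t m)) ->
  \sw_(m ⊗ h <- kernel_coact i j x) t (ι i m) h =
  \sw_(m ⊗ h <- rM i j (ι (i + j) x)) t m h.
Proof. by move=> l1 l2; rewrite -kernel_coactE (sw_tmap (ι i)). Qed.

Lemma kernel_hom_ecast i j (e : i = j) x :
  ι j (ecast n (K n) e x) = ecast n (M n) e (ι i x).
Proof. by case: j / e. Qed.

Lemma kernel_coassoc i j l (x : K (i + j + l)) :
  tmap idfun (hopf_Delta H j l)
    (kernel_coact i (j + l) (ecast n (K n) (esym (addrA i j l)) x)) =
  tassoc (tmap (kernel_coact i j) idfun (kernel_coact (i + j) l x)).
Proof.
apply: kernel_tens_inj; rewrite {1}/tmap sw_tmap; [|by lin..].
rewrite (sw_kernel_coact _ (t := fun m h => tens m (hopf_Delta H j l h)));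
  [|by lin..].
rewrite kernel_hom_ecast.
rewrite -[LHS]/(tmap idfun (hopf_Delta H j l) _) (coact_coassoc rM).
rewrite -[LHS]sw_tens sw_tassoc; [|by lin..].
rewrite (sw_tmap (rM i j)); [|by lin..].
rewrite [RHS]/(tmap _ _ _) sw_tassoc; [|by lin..].
rewrite (sw_tmap (kernel_coact i j)); [|by lin..].
rewrite -(sw_kernel_coact x (t := fun m w =>
  \sw_(a ⊗ b <- rM i j m) tens a (tens b w))); [|by lin..].
apply: eq_tlift => m w.
by rewrite -(sw_kernel_coact m (t := fun a b => tens a (tens b w))); lin.
Qed.

Lemma kernel_counit i (x : K (i + 0)) :
  trunit (tmap idfun (hopf_counit H) (kernel_coact i 0 x)) =
  ecast n (K n) (addr0 i) x.
Proof.
apply: kernel_hom_inj; rewrite kernel_hom_ecast -(coact_counit rM).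
rewrite /trunit !(sw_tmap idfun (hopf_counit H)); [|by lin..].
rewrite -(sw_kernel_coact x (t := fun m h => (hopf_counit H h : k) *: m));
  [|by lin..].
rewrite (sw_lin (f := ι i)); last exact: linearP.
by apply: eq_tlift => m h; rewrite linearZ_LR.
Qed.

Definition kernel_comodule : comodule_on H K :=
  ComoduleOn kernel_coassoc kernel_counit.

Lemma kernel_hom_colinear : colinear kernel_comodule rM ι.
Proof. by move=> i j x; rewrite -kernel_coactE. Qed.

Section Action.
Variables (A : comodulePoissonAlg H).
Variables (opM : forall i, {bilinear A i -> M i -> M i}).
Variables (opN : forall i, {bilinear A i -> N i -> N i}).
Hypothesis u_op : forall i (a : A i) m, u i (opM i a m) = opN i a (u i m).

Lemma kernel_op_subproof i (a : A i) (x : K i) : opM i a (ι i x) \in kerp (u i).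
Proof. by rewrite inE u_op kernel_hom0 linear0r. Qed.

Definition kernel_op_fun i (a : A i) (x : K i) : K i :=
  Kernel (kernel_op_subproof a x).

Lemma kernel_op_bilinear i : bilinear_for *:%R *:%R (@kernel_op_fun i).
Proof.
split=> [x|b] a y z; apply: kernel_hom_inj; rewrite linearP /=.
  exact: linearPl.
by rewrite -linearPr.
Qed.

Definition kernel_op i : {bilinear A i -> K i -> K i} :=
  HB.pack (@kernel_op_fun i)
    (bilinear_isBilinear.Build k (A i) (K i) (K i) *:%R *:%R (@kernel_op_fun i)
      (@kernel_op_bilinear i)).

Lemma kernel_opE i (a : A i) (x : K i) :
  ι i (kernel_op i a x) = opM i a (ι i x).
Proof. by []. Qed.

Lemma kernel_op_compatible :
  coact_compatible opM rM -> coact_compatible kernel_op kernel_comodule.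
Proof.
move=> cM i j a x; apply: kernel_tens_inj.
rewrite [LHS]kernel_coactE kernel_opE cM.
rewrite [RHS]/(tmap _ _ _) sw_tmap2; [|by lin..].
apply: eq_tlift => b c.
by rewrite -(sw_kernel_coact x (t := fun m d => tens (opM i b m) (c * d))); lin.
Qed.
End Action.
End KernelComodule.

(** * Kernels as objects of the categories, and injectivity of monomorphisms *)

Section KernelModules.
Variables (k : fieldType) (G : zmodType) (H : hopfGCoalgebra k G).
Variable A : comodulePoissonAlg H.

Section Lie.
Variables (X Y : lieModule A) (u : famhom X Y).
Hypothesis u_lie : lie_linear u.

Lemma kernel_dia_lie i (a b : A i) (x : kernel_fam u i) :
  kernel_op u_lie i (lie _ a b) x =
  kernel_op u_lie i a (kernel_op u_lie i b x) -
  kernel_op u_lie i b (kernel_op u_lie i a x).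
Proof. by apply: kernel_hom_inj; rewrite linearB !kernel_opE dia_lie. Qed.

Definition kernel_lieModule : lieModule A := LieModule kernel_dia_lie.

Lemma kernel_hom_lie : lie_linear (kernel_hom u : famhom kernel_lieModule X).
Proof. by []. Qed.
End Lie.

Section Poisson.
Variables (X Y : poissonModule A) (u : famhom X Y).
Hypothesis (u_lie : lie_linear u) (u_dot : dot_linear u).

(** Kept transparent: in [kernel_hopfModule] its underlying family must compute to
    [kernel_fam u]. *)
Definition kernel_poissonModule : poissonModule A.
Proof.
refine (@PoissonModule _ _ _ _ (kernel_lieModule u_lie) (kernel_op u_dot)
  _ _ _ _) => i *; apply: kernel_hom_inj.
- by rewrite kernel_opE dot1.
- by rewrite !kernel_opE dotA.
- by rewrite linearD !kernel_opE dia_dot.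
- by rewrite linearD !kernel_opE dia_mul.
Defined.
End Poisson.

Definition kernel_lieComodule (X Y : lieComodule A) (u : famhom X Y)
    (u_lie : lie_linear u) (u_co : colinear (lcom_coact X) (lcom_coact Y) u) :
    lieComodule A :=
  @LieComodule _ _ _ _ (kernel_lieModule u_lie) (kernel_comodule u_co)
    (kernel_op_compatible u_co u_lie (@lcom_dia _ _ _ _ X)).

Definition kernel_hopfModule (X Y : hopfModule A) (u : famhom X Y)
    (u_lie : lie_linear u) (u_dot : dot_linear u)
    (u_co : colinear (hmod_coact X) (hmod_coact Y) u) : hopfModule A :=
  @HopfModule _ _ _ _ (kernel_poissonModule u_lie u_dot) (kernel_comodule u_co)
    (kernel_op_compatible u_co u_lie (@hmod_dia _ _ _ _ X))
    (kernel_op_compatible u_co u_dot (@hmod_dot _ _ _ _ X)).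

Lemma null_colinear (M N : G -> lmodType k) (rM : comodule_on H M)
    (rN : comodule_on H N) : colinear rM rN (fun i => \0%R : {linear M i -> N i}).
Proof.
move=> i j x; rewrite /= linear0; symmetry; apply: big1 => p _ /=.
by rewrite -[0 in LHS](scale0r (0 : N i)) (lin_Z (f := (@tens _ _ _)^~ _))
  ?scale0r //; lin.
Qed.

Lemma kernel0_inj (M N : G -> lmodType k) (u : famhom M N) :
  (forall i (x : kernel_fam u i), kernel_hom u i x = 0) ->
  forall i, injective (u i).
Proof.
move=> K0 i x y uxy; apply/eqP; rewrite -subr_eq0; apply/eqP.
have k_xy : x - y \in kerp (u i) by rewrite inE linearB uxy subrr.
exact: (K0 i (Kernel k_xy)).
Qed.

(** The kernel inclusion and the zero map are morphisms with the same composite with u, so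
    cancellation makes the kernel zero. *)
Lemma lieComodule_mono_inj (X Y : lieComodule A) (u : famhom X Y) :
  @monomorphism k G (lieComoduleCat A) X Y u -> forall i, injective (u i).
Proof.
move=> [[u_lie u_co] cancel_u]; apply: kernel0_inj.
apply: (cancel_u (kernel_lieComodule u_lie u_co) (kernel_hom u)
  (fun i => \0%R : {linear kernel_fam u i -> X i})).
- by split; [apply: kernel_hom_lie|apply: kernel_hom_colinear].
- split=> [i a m|]; last exact: null_colinear.
  by rewrite /= linear0r.
- by move=> i z; rewrite kernel_hom0 linear0.
Qed.

Lemma hopfModule_mono_inj (X Y : hopfModule A) (u : famhom X Y) :
  @monomorphism k G (hopfModuleCat A) X Y u -> forall i, injective (u i).
Proof.
move=> [[u_dot u_lie u_co] cancel_u]; apply: kernel0_inj.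
apply: (cancel_u (kernel_hopfModule u_lie u_dot u_co) (kernel_hom u)
  (fun i => \0%R : {linear kernel_fam u i -> X i})).
- by split; [by []|apply: kernel_hom_lie|apply: kernel_hom_colinear].
- split=> [i a m|i a m|]; last exact: null_colinear.
    by rewrite /= linear0r.
  by rewrite /= linear0r.
- by move=> i z; rewrite kernel_hom0 linear0.
Qed.

(** Injectivity concerns only the underlying maps, so it carries a monomorphism over to the category
    without coaction. *)
Lemma injective_mono (C : famCategory k G) (X Y : fobj C)
    (u : famhom (ffam X) (ffam Y)) :
  fhom u -> (forall i, injective (u i)) -> monomorphism u.
Proof. by move=> hu iu; split=> // Z g h _ _ gh i z; apply: iu. Qed.
End KernelModules.

(** * Passing injectivity from modules to modules with coaction *)

Theorem theorem0p1 (k : fieldType) (G : zmodType) (H : hopfGCoalgebra k G)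
    (H_antipode : bijective_antipode H) (A : comodulePoissonAlg H)
    (phi : famhom (fun i : G => H i) (fun i : G => A i))
    (phi_center : forall (i : G) (x : H i), poisson_center (phi i x))
    (phi_colinear : colinear (hopf_comodule H) (cpa_coact A) phi)
    (phi_unit : forall i : G, phi i 1 = 1) :
  (hopf_commutative H \/ (forall i : G, GRing.monoid_morphism (phi i)) ->
   forall M : hopfModule A,
     @injective_object k G (lieModuleCat A) M ->
     @injective_object k G (lieComoduleCat A) (hmod_lieComodule M)) /\
  (hopf_commutative H /\ (forall i : G, GRing.monoid_morphism (phi i)) ->
   forall M : hopfModule A,
     @injective_object k G (poissonModuleCat A) M ->
     @injective_object k G (hopfModuleCat A) M).
Proof.
(* Centrality of phi(x) kills the term {a, phi(x)} . m. *)
have dia_phi (M : hopfModule A) i (a : A i) (x : H i) (m : M i) :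
    dia M i a (dot M i (phi i x) m) = dot M i (phi i x) (dia M i a m).
  by rewrite dia_dot phi_center linear0l add0r.
have dot_phi (M : hopfModule A) i (a : A i) (x : H i) (m : M i) :
    dot M i a (dot M i (phi i x) m) = dot M i (phi i x) (dot M i a m).
  by rewrite -!dotA poisson_mulC.
split=> comm M injM X Y u f mono_u; have iu := mono_u.1.
- move=> [f_lie f_co]; have [u_lie u_co] := iu.
  have u_inj := lieComodule_mono_inj mono_u.
  have [g g_lie guf] := injM X Y u f
    (injective_mono (C := lieModuleCat A) u_lie u_inj) f_lie.
  exists (average H_antipode phi (lcom_coact Y) g); last first.
    exact: (average_id H_antipode phi_unit u_co f_co guf).
  split; last exact: average_colinear.
  exact: (average_act H_antipode phi_unit
    (@lcom_dia _ _ _ _ Y) (@hmod_dia _ _ _ _ M) (dia_phi M) comm g_lie).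
- move=> [f_dot f_lie f_co]; have [u_dot u_lie u_co] := iu.
  have u_inj := hopfModule_mono_inj mono_u.
  have [g [g_lie g_dot] guf] := injM X Y u f
    (injective_mono (C := poissonModuleCat A) (conj u_lie u_dot) u_inj)
    (conj f_lie f_dot).
  have comm' : hopf_commutative H \/ (forall i, GRing.monoid_morphism (phi i)).
    by left; apply: comm.1.
  exists (average H_antipode phi (hmod_coact Y) g); last first.
    exact: (average_id H_antipode phi_unit u_co f_co guf).
  split; last exact: average_colinear.
    exact: (average_act H_antipode phi_unit
      (@hmod_dot _ _ _ _ Y) (@hmod_dot _ _ _ _ M) (dot_phi M) comm' g_dot).
  exact: (average_act H_antipode phi_unit
    (@hmod_dia _ _ _ _ Y) (@hmod_dia _ _ _ _ M) (dia_phi M) comm' g_lie).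
Qed.
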